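(* Fix $\lambda\in K$ with $\lambda\ne 0$, and let $$F_0(x,y)=(f(x),\ \lambda y(1+g(x))),$$ where $f$ and $g$ are one-variable power series that are locally $K$-analytic at $0$, with $f(x)=x+\rho x^m+O(x^{m+1})$ for some integer $m\ge 2$ and some $\rho\in K$, $\rho\neq 0$, and $g(0)=0$. Then there are a polynomial $r(x)\in K[x]$ with $r(0)=0$ and $\deg r<m$, an analytic mapping $H(x,y)=(h(x),\,y\,k(x))$ with $h$ tangent to the identity and $k(0)=1$, and an element $\mu\in K$, such that $$H\circ F_0\circ H^{-1}(x,y)=\bigl(x+\rho x^m+\mu x^{2m-1},\ \lambda y(1+r(x))\bigr).$$
   Context: $K$ is a complete, nontrivially valued non-archimedean field of characteristic $0$. ''Analytic at $0$'' means given by power series converging in some polydisc (ball, in one variable) containing $0$. A one-variable series $h$ is tangent to the identity if $h(x)=x+O(x^2)$. *)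

(* Defs.v *)
From HB Require Import structures.
From mathcomp Require Import all_boot all_order all_algebra.
From mathcomp Require Import all_classical all_reals all_analysis.
Import numFieldNormedType.Exports.

Set Implicit Arguments.
Unset Strict Implicit.
Unset Printing Implicit Defensive.

Import Order.TTheory GRing.Theory Num.Theory.

Local Open Scope classical_set_scope.
Local Open Scope ring_scope.

(* The library's norm structures (normedZmodType and its descendants) cannot be
   used here: they impose `|x *+ n| = `|x| *+ n, which contradicts the
   ultrametric inequality.  Nor can a field that is not a normed module be
   joined with completePseudoMetricType, as the hierarchy lacks the
   intermediate structures.  Hence a field with its own real absolute value, in
   which u converges to l when |u_n - l| tends to 0 in R. *)
HB.mixin Record Field_isNonArchValued (R : realType) K & GRing.Field K := {
  vabs : K -> R ;
  vabs_ge0 : forall x, 0 <= vabs x ;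
  vabs_eq0 : forall x, vabs x = 0 <-> x = 0 ;
  vabsM : forall x y, vabs (x * y) = vabs x * vabs y ;
  vabsD_max : forall x y, vabs (x + y) <= Num.max (vabs x) (vabs y) ;
  vabs_nontrivial : exists x, x != 0 /\ vabs x != 1 ;
  vabs_complete : forall u : nat -> K,
    (forall e : R, 0 < e -> exists N : nat,
       forall i j : nat, (N <= i)%N -> (N <= j)%N -> vabs (u i - u j) < e) ->
    exists l : K, (fun n => vabs (u n - l)) @ \oo --> (0 : R)
}.

#[short(type="completeNonArchFieldType")]
HB.structure Definition CompleteNonArchField (R : realType) :=
  {K of GRing.Field K & Field_isNonArchValued R K}.

Section PowerSeries.
Context {R : realType} {K : completeNonArchFieldType R}.

Definition vcvg_to (u : nat -> K) (l : K) : Prop :=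
  (fun n => vabs (u n - l) : R) @ \oo --> (0 : R).

(* A one-variable power series is given by its coefficients a : nat -> K. *)

Definition ps_sums_to (a : nat -> K) (x l : K) : Prop :=
  vcvg_to (series (fun n => a n * x ^+ n)) l.

(* The sum of the series; 0 where it diverges. *)
Definition ps_eval (a : nat -> K) (x : K) : K := xget 0 (ps_sums_to a x).

Definition ps_analytic (a : nat -> K) : Prop :=
  exists2 r : R, 0 < r &
    forall x : K, vabs x < r -> exists l : K, ps_sums_to a x l.

(* a = p + O(x^n) *)
Definition ps_eqO (n : nat) (a : nat -> K) (p : {poly K}) : Prop :=
  forall i, (i < n)%N -> a i = p`_i.

Definition tangent_to_id (h : nat -> K) : Prop := ps_eqO 2 h 'X.

(* P holds on some polydisc around the origin of K^2. *)
Definition near_origin (P : K * K -> Prop) : Prop :=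
  exists2 r : R, 0 < r &
    forall p : K * K, vabs p.1 < r -> vabs p.2 < r -> P p.

(* G represents the germ at the origin of the inverse of H; when H is a local
   homeomorphism fixing the origin, this determines the germ of G. *)
Definition inverse_germ (H G : K * K -> K * K) : Prop :=
  near_origin (fun p => H (G p) = p) /\ near_origin (fun p => G (H p) = p).

Definition F0_map (lambda : K) (f g : nat -> K) : K * K -> K * K :=
  fun p => (ps_eval f p.1, lambda * p.2 * (1 + ps_eval g p.1)).

Definition H_map (h k : nat -> K) : K * K -> K * K :=
  fun p => (ps_eval h p.1, p.2 * ps_eval k p.1).

Definition normal_form (lambda rho mu : K) (m : nat) (r : {poly K}) :
    K * K -> K * K :=
  fun p => (p.1 + rho * p.1 ^+ m + mu * p.1 ^+ (2 * m - 1),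
            lambda * p.2 * (1 + r.[p.1])).

End PowerSeries.

(* Main.v *)
Require Import Defs.
From mathcomp Require Import all_boot all_order all_algebra.
From mathcomp Require Import all_classical all_reals all_analysis.
From mathcomp Require Import ring lra zify.

Set Implicit Arguments.
Unset Strict Implicit.
Unset Printing Implicit Defensive.

Import Order.TTheory GRing.Theory Num.Theory.
Import numFieldNormedType.Exports.

Local Open Scope classical_set_scope.
Local Open Scope ring_scope.

(** Why the theorem holds.  Comparing coefficients in
    [h (f x) = h x + rho * h x ^+ m + mu * h x ^+ (2 * m - 1)], the one of
    [x ^+ (n + m - 1)] reads [(n - m) * rho * h_n = (a polynomial in h_j, j < n)].
    As the characteristic is 0 this determines [h_n] for [n != m], and for
    [n = m], where the left side vanishes, the equation determines [mu] instead.
    Likewise the fibre equation [k (f x) * (1 + g x) = k x * (1 + r (h x))]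
    forces [r] to be the polynomial of degree less than [m] for which [r (h x)]
    and [g x] agree below order [m], and then reads
    [n * rho * k_n = (a linear form in k_j, j < n)].  So a formal solution
    exists ([formal_conjugacy], [formal_fibre_conjugacy]).

    Over the complex numbers [h] would in general diverge.  Here it converges:
    integers, hence binomial coefficients and the other combinatorial
    constants, have absolute value at most 1, so the only source of growth
    beyond a geometric one is the repeated division by [n - m], and the
    products of these small divisors are at worst [1 / vabs (n - m)`!].  These
    are supermultiplicative, since [a`! * b`!] divides [(a + b)`!], so the
    bound propagates through the nonlinear recursion ([conjugacy_bound],
    [fibre_conjugacy_bound]); and in a non-archimedean field of characteristic
    0 they are geometrically bounded ([vabs_fact_ge]).

    All series are handled through their polynomial truncations.  The
    truncations of a formal solution satisfy the equations up to a polynomial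
    defect that is divisible by ever higher powers of the indeterminate and has
    uniformly geometric coefficients, so that it tends to 0 on a small disc;
    the functional equations follow by passing to the limit
    ([conjugacy_equation], [fibre_conjugacy_equation]).  Finally [h] is an
    isometry of a small disc onto itself, by Banach's fixed point theorem
    ([ps_eval_onto]), and [k] does not vanish there, which gives the inverse
    germ. *)

(** * Non-archimedean absolute values *)

Section AbsoluteValue.
Context {R : realType} {K : completeNonArchFieldType R}.
Implicit Types x y : K.

Lemma vabs0 : vabs (0 : K) = 0 :> R.
Proof. exact/vabs_eq0. Qed.

Lemma vabs_gt0 x : x != 0 -> 0 < (vabs x : R).
Proof.
move=> x0; rewrite lt_neqAle vabs_ge0 andbT eq_sym.
by apply: contra x0 => /eqP/vabs_eq0/eqP.
Qed.

Lemma vabs1 : vabs (1 : K) = 1 :> R.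
Proof.
have v10 : vabs (1 : K) != 0 :> R by rewrite gt_eqF// vabs_gt0// oner_neq0.
by apply: (mulfI v10); rewrite -vabsM !mulr1.
Qed.

Lemma vabsX x n : vabs (x ^+ n) = vabs x ^+ n :> R.
Proof.
by elim: n => [|n IH]; [rewrite !expr0 vabs1 | rewrite !exprS vabsM IH].
Qed.

Lemma vabsN x : vabs (- x) = vabs x :> R.
Proof.
suff e : vabs (-1 : K) = 1 :> R by rewrite -mulN1r vabsM e mul1r.
apply/eqP; rewrite -(eqrXn2 (n := 2)) ?vabs_ge0//.
by rewrite -vabsX sqrrN !expr1n vabs1.
Qed.

Lemma vabsV x : vabs x^-1 = (vabs x)^-1 :> R.
Proof.
have [->|x0] := eqVneq x 0; first by rewrite invr0 vabs0 invr0.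
have vx0 : vabs x != 0 :> R by rewrite gt_eqF// vabs_gt0.
by apply: (mulfI vx0); rewrite -vabsM !divff// vabs1.
Qed.

Lemma vabsD_le x y (c : R) : vabs x <= c -> vabs y <= c -> vabs (x + y) <= c.
Proof.
by move=> xc yc; apply: le_trans (vabsD_max _ _) _; rewrite ge_max xc yc.
Qed.

Lemma vabsB_le x y (c : R) : vabs x <= c -> vabs y <= c -> vabs (x - y) <= c.
Proof. by move=> xc yc; apply: vabsD_le; rewrite ?vabsN. Qed.

Lemma vabs_sum_le (I : Type) (r : seq I) (P : pred I) (F : I -> K) (c : R) :
  0 <= c -> (forall i, P i -> vabs (F i) <= c) ->
  vabs (\sum_(i <- r | P i) F i) <= c.
Proof.
move=> c0 Fc; elim/big_ind: _ => //; first by rewrite vabs0.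
by move=> x y; apply: vabsD_le.
Qed.

Lemma vabs_nat_le1 n : vabs (n%:R : K) <= 1 :> R.
Proof.
elim: n => [|n IH]; first by rewrite vabs0.
by rewrite -natr1 vabsD_le ?vabs1.
Qed.

(** In an ultrametric triangle the two longest sides are equal. *)
Lemma vabsD_small x y : (vabs y < vabs x :> R) -> vabs (x + y) = vabs x :> R.
Proof.
move=> yx; apply/eqP; rewrite eq_le vabsD_le ?(ltW yx)//= leNgt.
apply/negP => lt; have : vabs (x + y - y) < vabs x :> R.
  by apply: le_lt_trans (vabsD_max _ _) _; rewrite vabsN gt_max lt yx.
by rewrite addrK ltxx.
Qed.

(** If some positive integer has absolute value less than 1, let [p] be the
    least one. Then [vabs k = 1] for all [k] not divisible by [p] (write
    [k = q * p + r] with [0 < r < p]), so only the [n %/ p] multiples of [p]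
    contribute to [vabs n`!]. *)
Lemma vabs_fact_ge : [pchar K] =i pred0 ->
  exists2 c : R, 0 < c <= 1 & forall n, c ^+ n <= vabs (n`!%:R : K).
Proof.
move=> /pcharf0P charK0.
have nat_gt0 n : (0 < n)%N -> 0 < (vabs (n%:R : K) : R).
  by move=> n0; apply: vabs_gt0; rewrite charK0 -lt0n.
have [[n0]|all1] := pselect (exists n, (0 < n)%N && ((vabs (n%:R : K) : R) < 1));
    last first.
  exists 1; first by rewrite ltr01 lexx.
  move=> n; rewrite expr1n leNgt; apply/negP => lt1.
  by apply: all1; exists n`!; rewrite fact_gt0.
move=> n0P; have exP := ex_intro (fun n => _) n0 n0P.
case: (ex_minnP exP) => p /andP[p_gt0 p_lt1] p_min {n0 n0P exP}.
have p_ge2 : (1 < p)%N.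
  by case: p p_gt0 p_lt1 {p_min} => [|[|p]] //; rewrite vabs1 ltxx.
have coprime1 k : ~~ (p %| k)%N -> vabs (k%:R : K) = 1 :> R.
  move=> pk.
  have r1 : vabs ((k %% p)%:R : K) = 1 :> R.
    have r0 : (0 < k %% p)%N by rewrite lt0n.
    apply/eqP; rewrite eq_le vabs_nat_le1 /= leNgt; apply/negP => r_lt1.
    have := p_min (k %% p)%N; rewrite r0 r_lt1 => /(_ isT).
    by rewrite leqNgt ltn_pmod.
  rewrite (divn_eq k p) addnC natrD vabsD_small r1// natrM vabsM.
  by apply: le_lt_trans p_lt1; rewrite ler_piMl ?vabs_ge0 ?vabs_nat_le1.
set c := vabs (p%:R : K) : R.
have c_gt0 : 0 < c by apply: nat_gt0.
exists c; first by rewrite c_gt0 ltW.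
have factE n : vabs (n`!%:R : K) = c ^+ (n %/ p) * vabs ((n %/ p)`!%:R : K) :> R.
  elim: n => [|n IH]; first by rewrite div0n fact0 expr0 mul1r.
  rewrite factS natrM vabsM IH divnS//.
  have [pn|pn] := boolP (p %| n.+1)%N; last by rewrite coprime1// mul1r add0n.
  have nE : n.+1 = (p * (n %/ p).+1)%N.
    by rewrite -[LHS](divnK pn) mulnC divnS// pn.
  rewrite add1n factS {1}nE exprS !natrM !vabsM -/c.
  by rewrite -!mulrA; congr (_ * _); rewrite mulrCA.
elim/ltn_ind => n IH.
have [->|n_gt0] := posnP n; first by rewrite fact0 vabs1.
have q_lt : (n %/ p < n)%N by rewrite ltn_Pdiv.
rewrite factE; apply: (@le_trans _ _ (c ^+ (n %/ p) * c ^+ (n %/ p))).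
  rewrite -exprD; apply: ler_wiXn2l; rewrite ?(ltW c_gt0) ?(ltW p_lt1)//.
  rewrite addnn -muln2; apply: leq_trans (leq_divM n p).
  by rewrite leq_mul2l p_ge2 orbT.
by rewrite ler_wpM2l ?IH// exprn_ge0// ltW.
Qed.

End AbsoluteValue.

(** * Weighted majorants of polynomials *)

Section InverseFactorial.
Context {R : realType} (K : completeNonArchFieldType R).
Hypothesis charK0 : [pchar K] =i pred0.

(** Growth of the products of small divisors [1 / (1 * 2 * ... * n)]. *)
Definition invfact (n : nat) : R := (vabs (n`!%:R : K))^-1.

Lemma vabs_fact_gt0 n : 0 < (vabs (n`!%:R : K) : R).
Proof. by apply: vabs_gt0; rewrite (pcharf0P _).1// -lt0n fact_gt0. Qed.

Lemma invfact_ge0 n : 0 <= invfact n.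
Proof. by rewrite invr_ge0 vabs_ge0. Qed.

Lemma invfact0 : invfact 0 = 1.
Proof. by rewrite /invfact vabs1 invr1. Qed.

Lemma invfactM a b : invfact a * invfact b <= invfact (a + b).
Proof.
rewrite /invfact -invfM lef_pV2 ?posrE ?mulr_gt0 ?vabs_fact_gt0//.
have /bin_fact <- : (a <= a + b)%N by rewrite leq_addr.
by rewrite addKn natrM vabsM natrM vabsM ler_piMl ?mulr_ge0 ?vabs_ge0 ?vabs_nat_le1.
Qed.

Lemma invfact_ge1 n : 1 <= invfact n.
Proof. by rewrite -[leLHS]invr1 lef_pV2 ?posrE ?vabs_fact_gt0// vabs_nat_le1. Qed.

Lemma invfact_le a b : (a <= b)%N -> invfact a <= invfact b.
Proof.
move=> ab; rewrite -(subnKC ab); apply: le_trans (invfactM _ _).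
by rewrite ler_peMr ?invfact_ge0 ?invfact_ge1.
Qed.

Lemma invfactS n : vabs (n.+1%:R : K) * invfact n.+1 = invfact n.
Proof.
rewrite /invfact factS natrM vabsM invfM mulrA divff ?mul1r// gt_eqF//.
by rewrite vabs_gt0// (pcharf0P _).1.
Qed.

Lemma invfact_geometric : exists2 C : R, 1 <= C & forall n, invfact n <= C ^+ n.
Proof.
have [c /andP[c0 c1] cP] := vabs_fact_ge charK0.
exists c^-1; first by rewrite -[leLHS]invr1 lef_pV2 ?posrE.
by move=> n; rewrite exprVn lef_pV2 ?posrE ?vabs_fact_gt0 ?exprn_gt0// cP.
Qed.

(** Weight of the coefficient of index [i]: geometric growth of ratio [A],
    times the small divisors that occur beyond the index [s]. *)
Definition fact_weight (A : R) (s i : nat) : R := A ^+ i * invfact (i - s).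

Lemma fact_weight_ge0 A s i : 0 <= A -> 0 <= fact_weight A s i.
Proof. by move=> A0; rewrite mulr_ge0 ?exprn_ge0 ?invfact_ge0. Qed.

Lemma fact_weightM A s a b : 0 <= A ->
  fact_weight A s a * fact_weight A s b <= fact_weight A s (a + b).
Proof.
move=> A0; rewrite /fact_weight exprD mulrACA ler_wpM2l ?mulr_ge0 ?exprn_ge0//.
by apply: le_trans (invfactM _ _) (invfact_le _); lia.
Qed.

End InverseFactorial.

Section WeightedBounds.
Context {R : realType} {K : completeNonArchFieldType R}.
Implicit Types (p q : {poly K}) (C D : R).

Definition wbound (V : nat -> R) C p := forall i, vabs p`_i <= C * V i.

Variable V : nat -> R.
Hypothesis V_ge0 : forall i, 0 <= V i.

Lemma wbound_le C D p : C <= D -> wbound V C p -> wbound V D p.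
Proof. by move=> CD pC i; apply: le_trans (pC i) _; rewrite ler_wpM2r. Qed.

Lemma wboundD C p q : wbound V C p -> wbound V C q -> wbound V C (p + q).
Proof. by move=> pC qC i; rewrite coefD vabsD_le. Qed.

Lemma wboundB C p q : wbound V C p -> wbound V C q -> wbound V C (p - q).
Proof. by move=> pC qC i; rewrite coefB vabsB_le. Qed.

Lemma wboundZ c C p : wbound V C p -> wbound V (vabs c * C) (c *: p).
Proof. by move=> pC i; rewrite coefZ vabsM -mulrA ler_wpM2l ?vabs_ge0. Qed.

Lemma wbound_sum (I : Type) (r : seq I) (P : pred I) (F : I -> {poly K}) C :
  0 <= C -> (forall i, P i -> wbound V C (F i)) ->
  wbound V C (\sum_(i <- r | P i) F i).
Proof.
by move=> C0 FC i; rewrite coef_sum vabs_sum_le ?mulr_ge0// => j /FC.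
Qed.

Lemma wboundXn C n : 0 <= C -> 1 <= C * V n -> wbound V C ('X^n).
Proof.
by move=> C0 CV i; rewrite coefXn; case: eqP => [->|_]; rewrite ?vabs1// vabs0 mulr_ge0.
Qed.

Hypothesis V_mul : forall a b, V a * V b <= V (a + b)%N.

Lemma wboundM C D p q : 0 <= C -> 0 <= D ->
  wbound V C p -> wbound V D q -> wbound V (C * D) (p * q).
Proof.
move=> C0 D0 pC qD n; rewrite coefM vabs_sum_le ?mulr_ge0// => i _.
rewrite vabsM; have -> : V n = V (i + (n - i))%N by rewrite subnKC// -ltnS.
apply: le_trans (_ : C * V i * (D * V (n - i)%N) <= _).
  by rewrite ler_pM ?vabs_ge0.
by rewrite mulrACA ler_wpM2l ?mulr_ge0.
Qed.

Hypothesis V0 : 1 <= V 0.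

Lemma wbound1 : wbound V 1 1.
Proof. by rewrite -(expr0 'X); apply: wboundXn; rewrite ?mul1r. Qed.

Lemma wboundX C p n : 0 <= C -> wbound V C p -> wbound V (C ^+ n) (p ^+ n).
Proof.
move=> C0 pC; elim: n => [|n IH]; first exact: wbound1.
by rewrite !exprS; apply: wboundM; rewrite ?exprn_ge0.
Qed.

End WeightedBounds.

Section GeometricBounds.
Context {R : realType} {K : completeNonArchFieldType R}.
Implicit Types (p q : {poly K}).
Variable A : R.
Hypothesis A_ge1 : 1 <= A.
Let A_gt0 : 0 < A := lt_le_trans ltr01 A_ge1.

Notation gbound := (wbound (GRing.exp A)).

Lemma geom_ge0 i : 0 <= A ^+ i. Proof. by rewrite exprn_ge0 ?ltW. Qed.

Lemma geomM a b : A ^+ a * A ^+ b <= A ^+ (a + b). Proof. by rewrite exprD. Qed.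

Lemma gboundM C D p q : 0 <= C -> 0 <= D ->
  gbound C p -> gbound D q -> gbound (C * D) (p * q).
Proof. exact: (wboundM geom_ge0 geomM). Qed.

Lemma gboundX C p n : 0 <= C -> gbound C p -> gbound (C ^+ n) (p ^+ n).
Proof. by apply: (wboundX geom_ge0 geomM); rewrite expr0. Qed.

Lemma gbound_comp p q D : 0 <= D ->
  gbound D p -> gbound A^-1 q -> gbound D (p \Po q).
Proof.
move=> D0 pD qA; rewrite comp_polyE; apply: wbound_sum => [||i _] //.
  exact: geom_ge0.
apply: (wbound_le geom_ge0) (wboundZ p`_i (gboundX i _ qA)); last first.
  by rewrite invr_ge0 ltW.
by rewrite exprVn ler_pdivrMr ?exprn_gt0.
Qed.

(** The difference is [p - 'X] times a sum of products of [j - 1] factors [p]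
    or ['X], each of which contributes a factor [A^-1]. *)
Lemma gbound_expB_X p C j : 0 <= C ->
  gbound A^-1 p -> gbound C (p - 'X) ->
  gbound (C * (A^-1) ^+ j.-1) (p ^+ j - 'X^j).
Proof.
move=> C0 pA pC; have A'0 : 0 <= A^-1 by rewrite invr_ge0 ltW.
rewrite subrXX; apply: gboundM => //; first exact: exprn_ge0.
apply: wbound_sum => [||[i ij] _] /=; [exact: geom_ge0|exact: exprn_ge0|].
have -> : j.-1 = (j.-1 - i + i)%N by lia.
rewrite addnK exprD; apply: gboundM; rewrite ?exprn_ge0//; first exact: gboundX.
apply: wboundXn; [exact: geom_ge0|exact: exprn_ge0|].
by rewrite exprVn mulVf// expf_neq0// gt_eqF.
Qed.

End GeometricBounds.

(** * Congruences modulo powers of the indeterminate *)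

Section Congruences.
Context {F : fieldType}.
Implicit Types (p q : {poly F}).

Lemma dvdXnP n p : 'X^n %| p <-> (forall i, (i < n)%N -> p`_i = 0).
Proof.
split=> [/dvdpP[q ->] i i_lt|p0]; first by rewrite coefMXn i_lt.
rewrite -(poly_take_drop n p) dvdp_addl ?dvdp_mull//.
have -> : take_poly n p = 0; last by rewrite dvdp0.
by apply/polyP => i; rewrite coef_take_poly coef0; case: ifP => // /p0.
Qed.

Lemma dvdXn_coef n p i : 'X^n %| p -> (i < n)%N -> p`_i = 0.
Proof. by move/dvdXnP; apply. Qed.

Lemma dvdXnS n p : 'X^n %| p -> p`_n = 0 -> 'X^(n.+1) %| p.
Proof.
move=> pn p0; apply/dvdXnP => i; rewrite ltnS leq_eqVlt => /orP[/eqP->//|].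
exact: dvdXn_coef.
Qed.

Lemma dvdXn_le m n p : (m <= n)%N -> 'X^n %| p -> 'X^m %| p.
Proof. by move=> mn; apply: dvdp_trans; rewrite dvdp_exp2l. Qed.

Lemma dvdp_compB p q1 q2 : q1 - q2 %| (p \Po q1) - (p \Po q2).
Proof.
rewrite !comp_polyE -sumrB; elim/big_rec: _ => [|i s _ IH]; first exact: dvdp0.
by rewrite dvdp_add// -scalerBr -mul_polyC dvdp_mull// subrXX dvdp_mulr.
Qed.

(** The mean value theorem modulo a power of the indeterminate: for [p] and [q]
    close to the identity, the derivative of the [M]-th power is close to
    [M * 'X^(M - 1)]. *)
Lemma expB_lead n M p q :
  p`_0 = 0 -> p`_1 = 1 -> q`_0 = 0 -> q`_1 = 1 -> 'X^n %| p - q ->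
  'X^(n + M) %| p ^+ M - q ^+ M - (M%:R * (p - q)`_n) *: 'X^(n + M.-1).
Proof.
move=> p0 p1 q0 q1 /dvdpP[d pqE].
have [->|M_gt0] := posnP M; first by rewrite !expr0 subrr mul0r scale0r subr0 dvdp0.
have XE (r : {poly F}) : r`_0 = 0 -> r`_1 = 1 -> exists2 u, r = u * 'X & u.[0] = 1.
  move=> r0 r1; have /dvdpP[u uE] : 'X^1 %| r by apply/dvdXnP => -[].
  by exists u => //; rewrite horner_coef0 -r1 uE expr1 coefMX.
have [[u pE u1] [v qE v1]] := (XE p p0 p1, XE q q0 q1).
pose S := \sum_(i < M) u ^+ (M.-1 - i) * v ^+ i.
have S0 : S.[0] = M%:R.
  rewrite horner_sum (eq_bigr (fun=> 1)) => [|i _].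
    by rewrite sumr_const card_ord.
  by rewrite hornerM !horner_exp u1 v1 !expr1n mulr1.
have -> : p ^+ M - q ^+ M = d * S * 'X^(n + M.-1).
  rewrite subrXX pqE exprD.
  have -> : \sum_(i < M) p ^+ (M.-1 - i) * q ^+ i = S * 'X^(M.-1).
    rewrite mulr_suml; apply: eq_bigr => -[i iM] _ /=.
    rewrite pE qE !exprMn mulrACA -exprD; congr (_ * 'X^_); lia.
  by ring.
have -> : (p - q)`_n = d.[0] by rewrite pqE coefMXn ltnn subnn horner_coef0.
rewrite -mul_polyC -mulrBl; have -> : (n + M = 1 + (n + M.-1))%N by lia.
rewrite exprD; apply: dvdp_mul => //; apply/dvdXnP => -[|//] _.
by rewrite -horner_coef0 !hornerE S0 mulrC subrr.
Qed.

Lemma dvdXn_expB_id n p : p`_0 = 0 -> p`_1 = 1 -> 'X^(n.+1) %| p ^+ n - 'X^n.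
Proof.
move=> p0 p1; have X0 : ('X : {poly F})`_0 = 0 by rewrite coefX.
have X1 : ('X : {poly F})`_1 = 1 by rewrite coefX.
have d2 : 'X^2 %| p - 'X.
  by apply/dvdXnP => -[_|[_|//]]; rewrite coefB coefX ?p0 ?p1 subrr.
have := expB_lead n p0 p1 X0 X1 d2; set c := (_ * _) => H.
rewrite -[_ - _](subrK (c *: 'X^(2 + n.-1))) dvdp_add//.
  by apply: dvdXn_le H.
by rewrite -mul_polyC dvdp_mull// dvdp_exp2l//; lia.
Qed.

End Congruences.

Section Truncation.
Context {F : fieldType}.
Implicit Types (a : nat -> F).

Definition trunc (N : nat) a : {poly F} := \poly_(i < N) a i.

Lemma coef_trunc N a i : (trunc N a)`_i = if (i < N)%N then a i else 0.
Proof. by rewrite coef_poly. Qed.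

Lemma truncS N a : trunc N.+1 a = trunc N a + a N *: 'X^N.
Proof.
by rewrite /trunc !poly_def big_ord_recr.
Qed.

Lemma dvdXn_truncB m n N a : (N <= m)%N -> (N <= n)%N ->
  'X^N %| trunc m a - trunc n a.
Proof.
move=> Nm Nn; apply/dvdXnP => i iN.
by rewrite coefB !coef_trunc !(leq_trans iN)// subrr.
Qed.

Lemma take_trunc m n a : (m <= n)%N -> take_poly m (trunc n a) = trunc m a.
Proof.
move=> mn; apply/polyP => i; rewrite coef_take_poly !coef_trunc.
by case: ifP => // im; rewrite (leq_trans im).
Qed.

(** A coefficient sequence may be defined by giving each coefficient as a
    function of the polynomial formed by the previous ones. *)
Lemma course_of_values_series (S : nat -> {poly F} -> F) :
  exists a, forall n, a n = S n (trunc n a).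
Proof.
pose fix T n := if n is n'.+1 then T n' + S n' (T n') *: 'X^n' else 0.
exists (fun n => S n (T n)) => n; congr S.
elim: n => [|n IH] /=; last by rewrite truncS -IH.
by apply/polyP => i; rewrite coef_trunc coef0.
Qed.

End Truncation.

(** * The conjugacy of the first components *)

Section FirstComponent.
Context {R : realType} {K : completeNonArchFieldType R}.
Variables (m : nat) (rho : K) (f : nat -> K).
Hypotheses (charK0 : [pchar K] =i pred0) (m_ge2 : (2 <= m)%N).
Hypotheses (rho_neq0 : rho != 0) (f_jet : ps_eqO m.+1 f ('X + rho *: 'X^m)).
Implicit Types (P : {poly K}) (mu c : K) (h : nat -> K).

(** The failure of [P] to conjugate [f], truncated at order [N], to the normal
    form. *)
Definition conj_defect mu N P :=
  P \Po trunc N f - (P + rho *: P ^+ m + mu *: P ^+ (2 * m - 1)).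

Lemma natrB_neq0 n : n != m -> (n%:R - m%:R : K) != 0.
Proof.
have nz k : (0 < k)%N -> (k%:R : K) != 0 by rewrite (pcharf0P _).1// lt0n.
rewrite neq_ltn => /orP[] lt; last by rewrite -natrB ?nz ?subn_gt0// ltnW.
by rewrite -opprB oppr_eq0 -natrB ?nz ?subn_gt0// ltnW.
Qed.

Lemma f_coef0 : f 0 = 0.
Proof.
rewrite f_jet// coefD coefX coefZ coefXn.
have -> : (0 == m)%N = false by move: m_ge2; clear; lia.
by rewrite mulr0 addr0.
Qed.

Lemma f_coef1 : f 1 = 1.
Proof.
rewrite f_jet//; last by rewrite ltnS ltnW.
rewrite coefD coefX coefZ coefXn.
have -> : (1 == m)%N = false by move: m_ge2; clear; lia.
by rewrite mulr0 addr0.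
Qed.

Lemma dvd_truncB_jet N : (m < N)%N -> 'X^(m.+1) %| trunc N f - ('X + rho *: 'X^m).
Proof.
move=> mN; apply/dvdXnP => i im; rewrite coefB coef_trunc.
by rewrite (leq_trans im)// f_jet// subrr.
Qed.

Lemma jet_lead N : (m < N)%N ->
  'X^m %| trunc N f - 'X /\ (trunc N f - 'X)`_m = rho.
Proof.
move=> mN; have qd := dvd_truncB_jet mN; set q := trunc N f in qd *.
split.
  have -> : q - 'X = q - ('X + rho *: 'X^m) + rho *: 'X^m by ring.
  by apply: dvdp_add; [exact: dvdXn_le qd|rewrite -mul_polyC dvdp_mull].
have /eqP := dvdXn_coef qd (leqnn m.+1).
by rewrite opprD addrA coefB subr_eq0 coefZ coefXn eqxx mulr1 => /eqP.
Qed.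

Lemma conj_defect_trunc mu N N1 N2 P : (N <= N1)%N -> (N <= N2)%N ->
  'X^N %| conj_defect mu N1 P - conj_defect mu N2 P.
Proof.
move=> N1P N2P; rewrite /conj_defect opprB addrA subrK.
exact: dvdp_trans (dvdXn_truncB _ N1P N2P) (dvdp_compB _ _ _).
Qed.

Lemma conj_defect_mu mu1 mu2 N P :
  conj_defect mu1 N P - conj_defect mu2 N P = (mu2 - mu1) *: P ^+ (2 * m - 1).
Proof. by rewrite /conj_defect -!mul_polyC polyCB; ring. Qed.

(** The divisor [n - m] comes from the linear parts [n * rho] and [m * rho] of
    the effect of a new term on both sides of the conjugacy equation. *)
Lemma conj_defect_step mu c n N P :
  (2 <= n)%N -> (n + m <= N)%N -> P`_0 = 0 -> P`_1 = 1 ->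
  'X^(n + m) %| conj_defect mu N (P + c *: 'X^n) - conj_defect mu N P
                - (c * ((n%:R - m%:R) * rho)) *: 'X^(n + m.-1).
Proof.
move=> n2 nN P0 P1; set Q := P + c *: 'X^n.
have Xn_low i : (i < 2)%N -> ('X^n : {poly K})`_i = 0.
  by move=> i2; rewrite coefXn; have -> : (i == n)%N = false by lia.
have Q0 : Q`_0 = 0 by rewrite coefD P0 coefZ Xn_low// mulr0 addr0.
have Q1 : Q`_1 = 1 by rewrite coefD P1 coefZ Xn_low// mulr0 addr0.
have QP : Q - P = c *: 'X^n by rewrite addrC addKr.
have QPd : 'X^n %| Q - P by rewrite QP -mul_polyC dvdp_mull.
have QPn : (Q - P)`_n = c by rewrite QP coefZ coefXn eqxx mulr1.
have mN : (m < N)%N by apply: leq_trans nN; lia.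
set q := trunc N f.
have q0 : q`_0 = 0 by rewrite coef_trunc f_coef0 if_same.
have q1 : q`_1 = 1 by rewrite coef_trunc f_coef1; have -> : (1 < N)%N by lia.
have [qXd qXm] := jet_lead mN; rewrite -/q in qXd qXm.
have X0 : ('X : {poly K})`_0 = 0 by rewrite coefX.
have X1 : ('X : {poly K})`_1 = 1 by rewrite coefX.
have Hq := expB_lead n q0 q1 X0 X1 qXd; rewrite qXm in Hq.
have Hm := expB_lead m Q0 Q1 P0 P1 QPd.
have Hmu := expB_lead (2 * m - 1) Q0 Q1 P0 P1 QPd.
rewrite QPn in Hm Hmu.
have -> : conj_defect mu N Q - conj_defect mu N P
          - (c * ((n%:R - m%:R) * rho)) *: 'X^(n + m.-1) =
   c *: (q ^+ n - 'X^n - (n%:R * rho) *: 'X^(m + n.-1))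
   - rho *: (Q ^+ m - P ^+ m - (m%:R * c) *: 'X^(n + m.-1))
   - mu *: (Q ^+ (2 * m - 1) - P ^+ (2 * m - 1)).
  have -> : (m + n.-1 = n + m.-1)%N by lia.
  rewrite /conj_defect -/q {1}/Q comp_polyD comp_polyZ comp_Xn_poly {1}/Q.
  rewrite !scalerBr !scalerA.
  have -> : c * ((n%:R - m%:R) * rho) = c * (n%:R * rho) - rho * (m%:R * c).
    by ring.
  by rewrite scalerBl; ring.
apply: dvdp_sub; first apply: dvdp_sub.
- by rewrite -mul_polyC dvdp_mull// addnC.
- by rewrite -mul_polyC dvdp_mull.
rewrite -mul_polyC dvdp_mull//.
rewrite -[X in _ %| X](subrK (((2 * m - 1)%:R * c) *: 'X^(n + (2 * m - 1).-1))).
apply: dvdp_add; first by apply: dvdXn_le Hmu; lia.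
by rewrite -mul_polyC dvdp_mull// dvdp_exp2l; lia.
Qed.

(** At [n = m] the divisor vanishes; the obstruction is absorbed by [mu], on
    which the previous coefficients do not depend.  The recursion is stated
    only for [n > m], where its divisors [(n - m) * rho] multiply up to
    factorials. *)
Lemma formal_conjugacy : exists (h : nat -> K) mu,
  [/\ h 0 = 0, h 1 = 1,
      forall n, (m < n)%N -> ((n - m)%:R * rho) * h n =
         - (conj_defect mu (n + m) (trunc n h))`_(n + m.-1)
    & forall n, (0 < n)%N -> 'X^(n + m) %| conj_defect mu (n + m) (trunc n.+1 h)].
Proof.
pose mu_of P := (conj_defect 0 (m + m) P)`_(m + m.-1).
pose S n P := if n is n'.+2 then
    - (conj_defect (mu_of (take_poly m P)) (n + m) P)`_(n + m.-1)
      / ((n%:R - m%:R) * rho) else (n%:R : K).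
have [h hS] := course_of_values_series S.
have h0 : h 0 = 0 by rewrite hS.
have h1 : h 1 = 1 by rewrite hS.
have tr0 n : (trunc n h)`_0 = 0 by rewrite coef_trunc h0 if_same.
have tr1 n : (1 < n)%N -> (trunc n h)`_1 = 1 by rewrite coef_trunc h1 => ->.
set mu := mu_of (trunc m h).
have XnP k P : P`_0 = 0 -> 'X^k %| P ^+ k.
  by move=> P0; apply: dvdp_exp2r; rewrite -(expr1 'X); apply/dvdXnP => -[].
have hE n : (2 <= n)%N -> h n =
    - (conj_defect mu (n + m) (trunc n h))`_(n + m.-1) / ((n%:R - m%:R) * rho).
  move=> n2; rewrite hS /S; case: n n2 => [|[|n']] // _; set n := n'.+2.
  congr (- _ / _); have [mn|nm] := leqP m n; first by rewrite take_trunc.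
  apply/eqP; rewrite -subr_eq0 -coefB conj_defect_mu coefZ.
  by rewrite (dvdXn_coef (XnP _ _ (tr0 _))) ?mulr0//; lia.
have mu0 : (conj_defect mu (m + m) (trunc m h))`_(m + m.-1) = 0.
  rewrite -[conj_defect _ _ _](subrK (conj_defect 0 (m + m) (trunc m h))).
  rewrite conj_defect_mu coefD -/(mu_of _) -/mu sub0r coefZ.
  have -> : (trunc m h ^+ (2 * m - 1))`_(m + m.-1) = 1.
    have /dvdXn_coef/(_ (ltnSn _)) := dvdXn_expB_id (2 * m - 1) (tr0 m) (tr1 m m_ge2).
    have -> : (m + m.-1 = 2 * m - 1)%N by lia.
    by rewrite coefB coefXn eqxx => /eqP; rewrite subr_eq0 => /eqP.
  by rewrite mulr1 addNr.
exists h, mu; split => //.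
  move=> n mn; rewrite hE; last exact: leq_trans (ltnW mn).
  have nz : n%:R - m%:R != 0 :> K by rewrite natrB_neq0// gtn_eqF.
  by rewrite natrB ?(ltnW mn)// mulrC divfK// mulf_neq0.
move=> n n_gt0; elim: n n_gt0 => // n IH _.
have [->|n_gt0] := posnP n.
  have -> : trunc 2 h = 'X.
    by apply/polyP => -[|[|i]]; rewrite coef_trunc coefX ?h0 ?h1.
  have -> : conj_defect mu (1 + m) 'X =
      (trunc m.+1 f - ('X + rho *: 'X^m)) - mu *: 'X^(2 * m - 1).
    by rewrite /conj_defect comp_polyX opprD addrA.
  apply: dvdp_sub; first exact: dvd_truncB_jet.
  by rewrite -mul_polyC dvdp_mull// dvdp_exp2l; lia.
have {}IH := IH n_gt0; rewrite truncS; set P := trunc n.+1 h in IH *.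
have P1 : P`_1 = 1 by exact: tr1.
have step := conj_defect_step mu (h n.+1) (n_gt0 : 2 <= n.+1)%N
  (leqnn (n.+1 + m)) (tr0 _) P1.
have dP : 'X^(n + m) %| conj_defect mu (n.+1 + m) P.
  rewrite -(subrK (conj_defect mu (n + m) P) (conj_defect mu _ P)) dvdp_add//.
  by apply: conj_defect_trunc; rewrite ?leq_add2r.
rewrite {1}addSn; apply: dvdXnS.
  rewrite -[X in _ %| X](subrK (conj_defect mu (n.+1 + m) P)) dvdp_add//.
  set c := h n.+1 * ((n.+1%:R - m%:R) * rho).
  rewrite -[X in _ %| X](subrK (c *: 'X^(n.+1 + m.-1))).
  apply: dvdp_add; first by apply: dvdXn_le step; lia.
  by rewrite -mul_polyC dvdp_mull// dvdp_exp2l; lia.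
have iE : (n + m = n.+1 + m.-1)%N by lia.
have /(dvdXn_coef step) /eqP : (n.+1 + m.-1 < n.+1 + m)%N by lia.
rewrite iE coefB coefB coefZ coefXn eqxx mulr1 -addrA -opprD subr_eq0 => /eqP ->.
have [nm|nm] := eqVneq n.+1 m.
  by rewrite /P nm mu0 subrr mul0r mulr0 addr0.
rewrite hE // divfK ?mulf_neq0 ?natrB_neq0//; exact: subrr.
Qed.

End FirstComponent.

Section BinomialBounds.
Context {R : realType} {K : completeNonArchFieldType R}.
Variable V : nat -> R.
Hypotheses (V_ge0 : forall i, 0 <= V i) (V0 : 1 <= V 0).
Hypothesis V_mul : forall a b, V a * V b <= V (a + b)%N.

Lemma wbound_nat n : wbound V 1 (n%:R : {poly K}).
Proof.
have -> : (n%:R : {poly K}) = n%:R *: 1 by rewrite scaler_nat.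
by apply: (wbound_le V_ge0) (wboundZ _ (wbound1 V_ge0 V0)); rewrite mulr1 vabs_nat_le1.
Qed.

(** The recursion for [h] determines a new coefficient from the terms of degree
    at least 2 in the known ones, so that the linear term is to be split off
    before estimating. *)
Lemma expr1D_bound2 (y : {poly K}) M : wbound V 1 y ->
  exists2 T, (1 + y) ^+ M = 1 + M%:R * y + y ^+ 2 * T & wbound V 1 T.
Proof.
move=> y1; elim: M => [|M [T TE T1]].
  by exists 0; [ring | move=> i; rewrite coef0 vabs0 mul1r].
exists (M%:R + T + T * y); first by rewrite exprS TE -natr1; ring.
have := wboundM V_ge0 V_mul ler01 ler01 T1 y1; rewrite mulr1 => Ty1.
by apply: wboundD => //; apply: wboundD => //; apply: wbound_nat.
Qed.

Lemma expr1D_bound1 (y : {poly K}) M : wbound V 1 y ->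
  exists2 T, (1 + y) ^+ M = 1 + y * T & wbound V 1 T.
Proof.
move=> y1; have [T TE T1] := expr1D_bound2 M y1.
exists (M%:R + y * T); first by rewrite TE; ring.
have := wboundM V_ge0 V_mul ler01 ler01 y1 T1; rewrite mulr1 => yT1.
by apply: wboundD => //; apply: wbound_nat.
Qed.

End BinomialBounds.

Section ConjugacyBound.
Context {R : realType} {K : completeNonArchFieldType R}.
Variables (m : nat) (rho mu : K) (f h : nat -> K) (A : R).
Hypotheses (charK0 : [pchar K] =i pred0) (m_ge2 : (2 <= m)%N).
Hypotheses (rho_neq0 : rho != 0) (A_ge1 : 1 <= A).
Hypothesis rho_le : vabs rho <= A ^+ m.-1.
Hypothesis mu_le : vabs mu <= vabs rho * A ^+ m.-1.
Hypothesis f_le : forall i, vabs (f i - 'X`_i) <= vabs rho / A ^+ m * A ^+ i.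
Hypothesis h_le : forall n, (n <= m)%N -> vabs (h n) <= A^-1 * A ^+ n.
Hypotheses (h0 : h 0 = 0) (h1 : h 1 = 1).
Hypothesis h_rec : forall n, (m < n)%N -> ((n - m)%:R * rho) * h n =
  - (conj_defect m rho f mu (n + m) (trunc n h))`_(n + m.-1).

Let A_gt0 : 0 < A := lt_le_trans ltr01 A_ge1.
Let A_neq0 : A != 0 := lt0r_neq0 A_gt0.
Let W := @invfact R K.
Let V := @fact_weight R K A (m - 2).

Lemma gbound_jet N : (2 <= N)%N ->
  wbound (GRing.exp A) (vabs rho / A ^+ m) (trunc N f - 'X).
Proof.
move=> N2 i; rewrite coefB coef_trunc; case: ltnP => // Ni.
rewrite coefX; have -> : (i == 1)%N = false by move: N2 Ni; clear; lia.
by rewrite subr0 vabs0 !mulr_ge0 ?invr_ge0 ?vabs_ge0 ?exprn_ge0 // ltW.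
Qed.

Lemma gbound_trunc_jet N : (2 <= N)%N -> wbound (GRing.exp A) A^-1 (trunc N f).
Proof.
move=> N2; rewrite -(subrK 'X (trunc N f)).
apply: wboundD.
  apply: (wbound_le (geom_ge0 A_ge1)) (gbound_jet N2).
  rewrite ler_pdivrMr ?exprn_gt0//; apply: le_trans rho_le _.
  have -> : m = m.-1.+1 by move: m_ge2; clear; lia.
  by rewrite /= exprS mulKf.
apply: (wboundXn (geom_ge0 A_ge1) (n := 1)); first by rewrite invr_ge0 ltW.
by rewrite expr1 mulVf.
Qed.

(** Let [n > m], so that [n - m] is the last factor of [(n - m)`!].  It has to be
    seen that the right hand side of [h_rec] involves only the first
    [n - 1 - m] factors.  Write the truncation of [h] as
    ['X * (1 + 'X * psi)].  The induction hypothesis says that [psi] is bounded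
    by [A] for the supermultiplicative weight [V].  In the power of exponent
    [m], the term linear in [psi] would contain only the missing coefficient
    [h n], and the other terms are multiples of ['X^2 * psi ^+ 2], whose
    coefficient of index [n - 1] is bounded by the value of [V] at [n - 3],
    with [n - 3 - (m - 2) = n - 1 - m] factors. *)
Lemma conjugacy_bound n : vabs (h n) <= A^-1 * A ^+ n * W (n - m).
Proof.
elim/ltn_ind: n => n IH.
have [nm|mn] := leqP n m.
  apply: le_trans (h_le nm) _; rewrite ler_peMr ?invfact_ge1//.
  by rewrite mulr_ge0 ?exprn_ge0 ?invr_ge0 ?(ltW A_gt0).
have A'0 : 0 <= A^-1 by rewrite invr_ge0 ltW.
have N2 : (2 <= n + m)%N by lia.
have nmE : (n - m = (n.-1 - m).+1)%N by lia.
have hr := h_rec mn; set P := trunc n h in hr *.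
pose B := vabs rho * (A^-1 * A ^+ n) * W (n.-1 - m).
have B0 : 0 <= B.
  by rewrite /B !mulr_ge0 ?vabs_ge0 ?invfact_ge0 ?invr_ge0 ?exprn_ge0 ?(ltW A_gt0).
suff : vabs (conj_defect m rho f mu (n + m) P)`_(n + m.-1) <= B.
  rewrite -vabsN -hr !vabsM nmE => H.
  have d0 : 0 < (vabs ((n.-1 - m).+1%:R : K) : R).
    by rewrite vabs_gt0// (pcharf0P _).1.
  rewrite -(ler_pM2l (mulr_gt0 d0 (vabs_gt0 rho_neq0))).
  apply: le_trans H _; rewrite /B /W -invfactS// le_eqVlt; apply/orP; left.
  by apply/eqP; ring.
have V_ge0 i : 0 <= V i by apply: fact_weight_ge0; rewrite ltW.
have V_mul a b : V a * V b <= V (a + b)%N by apply: fact_weightM; rewrite ?(ltW A_gt0).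
have V0 : 1 <= V 0 by rewrite /V /fact_weight expr0 mul1r invfact_ge1.
pose psi : {poly K} := \poly_(i < n - 2) h i.+2.
have psiV : wbound V A psi.
  move=> i; rewrite coef_poly; case: ltnP => [i_lt|_]; last first.
    by rewrite vabs0 mulr_ge0 ?V_ge0 ?(ltW A_gt0).
  apply: le_trans (IH _ _) _; first by move: i_lt mn m_ge2; clear; lia.
  rewrite !exprS mulKf// /V /fact_weight -mulrA.
  by have -> : (i.+2 - m = i - (m - 2))%N by move: mn m_ge2; clear; lia.
have XV : wbound V A^-1 ('X : {poly K}).
  apply: (wboundXn V_ge0 (n := 1)) => //.
  by rewrite /V /fact_weight expr1 mulrA mulVf// mul1r invfact_ge1.
have XpsiV : wbound V 1 ('X * psi).
  by rewrite -(mulVf A_neq0); apply: wboundM => //; rewrite ltW.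
have PE : P = 'X * (1 + 'X * psi).
  apply/polyP => -[|[|i]]; rewrite coef_trunc coefXM ?h0 ?if_same//=.
    rewrite coefD coefXM coef1 /= addr0 h1.
    by have -> : (1 < n)%N by move: mn m_ge2; clear; lia.
  rewrite coefD coef1 add0r coefXM /= coef_poly; congr (if _ then _ else _).
  by move: mn m_ge2; clear; lia.
set i := (n + m.-1)%N; set q := trunc (n + m) f.
have -> : conj_defect m rho f mu (n + m) P =
    (P \Po q - P) - rho *: P ^+ m - mu *: P ^+ (2 * m - 1).
  by rewrite /conj_defect !opprD !addrA.
have AnE : A^-1 * A ^+ n = A ^+ n.-1.
  by rewrite -{1}(ltn_predK mn) exprS mulKf.
rewrite /B AnE coefB coefB; apply: vabsB_le; first apply: vabsB_le.
- rewrite -{2}(comp_polyXr P) !comp_polyE -sumrB coef_sum.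
  apply: vabs_sum_le => [|[j _] _ /=]; first by rewrite -AnE.
  rewrite -scalerBr coefZ vabsM coef_trunc; case: ltnP => [jn|_]; last first.
    by rewrite vabs0 mul0r -AnE.
  case: j jn => [|j] jn; first by rewrite h0 vabs0 mul0r -AnE.
  have C0 : 0 <= vabs rho / A ^+ m.
    by rewrite divr_ge0 ?vabs_ge0 ?exprn_ge0 ?(ltW A_gt0).
  have qb := gbound_expB_X A_ge1 j.+1 C0 (gbound_trunc_jet N2) (gbound_jet N2) i.
  have hb : vabs (h j.+1) <= A ^+ j * W (n.-1 - m).
    apply: le_trans (IH _ jn) _; rewrite exprS mulKf//.
    by rewrite ler_wpM2l ?exprn_ge0 ?(ltW A_gt0)// invfact_le//; move: jn; clear; lia.
  apply: le_trans (ler_pM (vabs_ge0 _) (vabs_ge0 _) hb qb) _.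
  have -> : i = (n.-1 + m)%N by move: mn m_ge2; clear; lia.
  rewrite /= exprVn exprD le_eqVlt; apply/orP; left; apply/eqP.
  have : A ^+ m != 0 by rewrite expf_neq0.
  have : A ^+ j != 0 by rewrite expf_neq0.
  by move: (A ^+ j) (A ^+ m) (A ^+ n.-1) => a b c a0 b0; field; rewrite a0.
- have [T TE T1] := expr1D_bound2 V_ge0 V0 V_mul m XpsiV.
  rewrite coefZ vabsM -mulrA ler_wpM2l ?vabs_ge0// PE exprMn coefXnM.
  have -> : (i < m)%N = false by move: mn m_ge2; clear; lia.
  have -> : (i - m = (n - 3).+2)%N by move: mn m_ge2; clear; lia.
  have -> : (1 + 'X * psi) ^+ m = 1 + ('X * psi) *+ m + 'X^2 * (psi * psi * T).
    by rewrite TE -mulr_natl; ring.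
  rewrite !coefD coef1 coefMn coefXM coefXnM /= subn2 /=.
  have -> : psi`_(n - 3).+1 = 0.
    by rewrite coef_poly; case: ltnP => //; move: mn m_ge2; clear; lia.
  rewrite mul0rn !add0r.
  have := wboundM V_ge0 V_mul _ ler01 (wboundM V_ge0 V_mul _ _ psiV psiV) T1.
  rewrite !mulr_ge0 ?(ltW A_gt0)// => /(_ isT isT isT (n - 3)%N).
  move=> /le_trans; apply; rewrite mulr1 /V /fact_weight mulrA -expr2 -exprD.
  have -> : (2 + (n - 3) = n.-1)%N by move: mn m_ge2; clear; lia.
  by have -> : (n - 3 - (m - 2) = n.-1 - m)%N by move: mn m_ge2; clear; lia.
have [T TE T1] := expr1D_bound1 V_ge0 V0 V_mul (2 * m - 1) XpsiV.
rewrite coefZ vabsM PE exprMn coefXnM TE.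
have -> : (i < 2 * m - 1)%N = false by move: mn m_ge2; clear; lia.
have -> : (i - (2 * m - 1) = (n - m - 1).+1)%N by move: mn m_ge2; clear; lia.
rewrite coefD coef1 add0r -mulrA coefXM /=.
have := wboundM V_ge0 V_mul _ ler01 psiV T1.
rewrite (ltW A_gt0) => /(_ isT (n - m - 1)%N) H.
apply: le_trans (ler_pM (vabs_ge0 _) (vabs_ge0 _) mu_le H) _.
rewrite -!mulrA ler_wpM2l ?vabs_ge0// mul1r /V /fact_weight.
have -> : A ^+ n.-1 = A ^+ m.-1 * A * A ^+ (n - m - 1).
  by rewrite -exprSr -exprD; congr (A ^+ _); lia.
rewrite -!mulrA !ler_wpM2l ?exprn_ge0 ?(ltW A_gt0)//.
by rewrite -[leRHS]mulr1 ?mulr1 invfact_le//; move: mn m_ge2; clear; lia.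
Qed.

End ConjugacyBound.

(** * The conjugacy in the fibres *)

Section SecondComponent.
Context {R : realType} {K : completeNonArchFieldType R}.
Variables (m : nat) (rho : K) (f g h : nat -> K).
Hypotheses (charK0 : [pchar K] =i pred0) (m_ge2 : (2 <= m)%N).
Hypotheses (rho_neq0 : rho != 0) (f_jet : ps_eqO m.+1 f ('X + rho *: 'X^m)).
Hypotheses (g0 : g 0 = 0) (h0 : h 0 = 0) (h1 : h 1 = 1).
Implicit Types (P r : {poly K}) (c : K) (k : nat -> K).

(** As the [i]-th power of [h] starts with ['X^i], the equations for the
    coefficients of [r] form a triangular system. *)
Lemma polynomial_in_h n : (0 < n)%N -> exists r,
  [/\ r.[0] = 0, (size r <= n)%N
    & forall N, (n <= N)%N -> 'X^n %| trunc N g - (r \Po trunc N h)].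
Proof.
elim: n => // n IH _; have [->|n_gt0] := posnP n.
  exists 0; split; rewrite ?horner0 ?size_poly0// => N N1.
  by rewrite comp_poly0 subr0; apply/dvdXnP => -[] // _; rewrite coef_trunc g0 if_same.
have [r [r0 rn rP]] := IH n_gt0.
pose c := (trunc n.+1 g - (r \Po trunc n.+1 h))`_n.
exists (r + c *: 'X^n); split.
- by rewrite !hornerE r0 add0r expr0n eqn0Ngt n_gt0 mulr0.
- rewrite (leq_trans (size_polyD _ _))// geq_max (leq_trans rn)//=.
  by rewrite (leq_trans (size_scale_leq _ _))// size_polyXn.
move=> N nN; have hN0 : (trunc N h)`_0 = 0 by rewrite coef_trunc h0 if_same.
have hN1 : (trunc N h)`_1 = 1.
  by rewrite coef_trunc h1; have -> : (1 < N)%N by move: nN n_gt0; clear; lia.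
have dvd_c : 'X^(n.+1) %| trunc N g - (r \Po trunc N h) - c *: 'X^n.
  apply: dvdXnS.
    by apply: dvdp_sub; [exact: rP (ltnW nN)|rewrite -mul_polyC dvdp_mull].
  rewrite coefB coefZ coefXn eqxx mulr1 /c -coefB; apply: (@dvdXn_coef _ n.+1) => //.
  have -> : forall a b a' b' : {poly K}, a - b - (a' - b') = (a - a') - (b - b').
    by move=> *; ring.
  apply: dvdp_sub; first exact: dvdXn_truncB.
  exact: dvdp_trans (dvdXn_truncB _ nN (leqnn _)) (dvdp_compB _ _ _).
rewrite comp_polyD comp_polyZ comp_Xn_poly.
have -> : trunc N g - (r \Po trunc N h + c *: trunc N h ^+ n) =
  (trunc N g - (r \Po trunc N h) - c *: 'X^n) - c *: (trunc N h ^+ n - 'X^n).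
  by rewrite scalerBr; ring.
by apply: dvdp_sub => //; rewrite -mul_polyC dvdp_mull// dvdXn_expB_id.
Qed.

Variable r : {poly K}.
Hypothesis r_jet :
  forall N, (m <= N)%N -> 'X^m %| trunc N g - (r \Po trunc N h).

Definition fibre_defect N P :=
  (P \Po trunc N f) * (1 + trunc N g) - P * (1 + (r \Po trunc N h)).

Lemma fibre_defect_trunc N N1 N2 P : (N <= N1)%N -> (N <= N2)%N ->
  'X^N %| fibre_defect N1 P - fibre_defect N2 P.
Proof.
move=> NN1 NN2; have dT (a : nat -> K) := dvdXn_truncB a NN1 NN2.
have dC (q : {poly K}) a : 'X^N %| (q \Po trunc N1 a) - (q \Po trunc N2 a).
  exact: dvdp_trans (dT a) (dvdp_compB _ _ _).
have -> : fibre_defect N1 P - fibre_defect N2 P =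
   (P \Po trunc N1 f) * (trunc N1 g - trunc N2 g)
   + ((P \Po trunc N1 f) - (P \Po trunc N2 f)) * (1 + trunc N2 g)
   - P * ((r \Po trunc N1 h) - (r \Po trunc N2 h)).
  by rewrite /fibre_defect; ring.
apply: dvdp_sub; first apply: dvdp_add; [exact: dvdp_mull| |exact: dvdp_mull].
exact: dvdp_mulr.
Qed.

Lemma fibre_defect_step c n N P : (n + m <= N)%N -> (0 < n)%N ->
  'X^(n + m) %| fibre_defect N (P + c *: 'X^n) - fibre_defect N P
                - (c * (n%:R * rho)) *: 'X^(n + m.-1).
Proof.
move=> nN n_gt0; have mN : (m < N)%N by lia.
set q := trunc N f; set gN := trunc N g.
have q0 : q`_0 = 0 by rewrite coef_trunc (f_coef0 m_ge2 f_jet) if_same.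
have q1 : q`_1 = 1.
  by rewrite coef_trunc (f_coef1 m_ge2 f_jet); have -> : (1 < N)%N by lia.
have X0 : ('X : {poly K})`_0 = 0 by rewrite coefX.
have X1 : ('X : {poly K})`_1 = 1 by rewrite coefX.
have [qXd qXm] := jet_lead f_jet mN.
have Hq := expB_lead n q0 q1 X0 X1 qXd; rewrite qXm -/q in Hq.
have gd : 'X %| gN.
  by rewrite -(expr1 'X); apply/dvdXnP => -[] // _; rewrite coef_trunc g0 if_same.
have -> : fibre_defect N (P + c *: 'X^n) - fibre_defect N P
    - (c * (n%:R * rho)) *: 'X^(n + m.-1) =
  c *: ((q ^+ n - 'X^n - (n%:R * rho) *: 'X^(m + n.-1)) * (1 + gN)
        + (n%:R * rho) *: ('X^(n + m.-1) * gN)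
        + 'X^n * (gN - (r \Po trunc N h))).
  have -> : (m + n.-1 = n + m.-1)%N by move: n_gt0 m_ge2; clear; lia.
  rewrite /fibre_defect -/q -/gN comp_polyD comp_polyZ comp_Xn_poly.
  rewrite -scalerA -!mul_polyC; ring.
rewrite -mul_polyC dvdp_mull//; apply: dvdp_add; first apply: dvdp_add.
- by rewrite dvdp_mulr// addnC.
- rewrite -mul_polyC dvdp_mull//.
  have -> : (n + m = (n + m.-1) + 1)%N by move: m_ge2; clear; lia.
  by rewrite exprD dvdp_mul.
by rewrite exprD dvdp_mul// r_jet// ltnW.
Qed.

(** The choice of [r] satisfies the equations below order [m]; beyond, the
    divisors [n * rho] with [n > 0] never vanish. *)
Lemma formal_fibre_conjugacy : exists k : nat -> K,
  [/\ k 0 = 1,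
      forall n, (0 < n)%N -> (n%:R * rho) * k n =
         - (fibre_defect (n + m) (trunc n k))`_(n + m.-1)
    & forall n, 'X^(n + m) %| fibre_defect (n + m) (trunc n.+1 k)].
Proof.
pose S n P := if n is 0 then 1 else
  - (fibre_defect (n + m) P)`_(n + m.-1) / (n%:R * rho).
have [k kS] := course_of_values_series S.
have k0 : k 0 = 1 by rewrite kS.
have kE n : (0 < n)%N -> (n%:R * rho) * k n =
         - (fibre_defect (n + m) (trunc n k))`_(n + m.-1).
  case: n => // n _; rewrite kS /S mulrC divfK// mulf_neq0//.
  by rewrite (pcharf0P _).1.
exists k; split => //; elim=> [|n IH].
  have -> : trunc 1 k = 1.
    by apply/polyP => -[|i]; rewrite coef_trunc coef1 ?k0.
  rewrite /fibre_defect add0n -polyC1 comp_polyC polyC1 !mul1r.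
  by rewrite opprD addrACA subrr add0r r_jet.
rewrite truncS; set P := trunc n.+1 k in IH *.
have step := fibre_defect_step (k n.+1) P (leqnn (n.+1 + m)) (ltn0Sn n).
have dP : 'X^(n + m) %| fibre_defect (n.+1 + m) P.
  rewrite -(subrK (fibre_defect (n + m) P) (fibre_defect _ P)) dvdp_add//.
  by apply: fibre_defect_trunc; rewrite ?leq_add2r.
rewrite {1}addSn; apply: dvdXnS.
  rewrite -[X in _ %| X](subrK (fibre_defect (n.+1 + m) P)) dvdp_add//.
  rewrite -[X in _ %| X](subrK ((k n.+1 * (n.+1%:R * rho)) *: 'X^(n.+1 + m.-1))).
  apply: dvdp_add; first by apply: dvdXn_le step; lia.
  by rewrite -mul_polyC dvdp_mull// dvdp_exp2l; lia.
have iE : (n + m = n.+1 + m.-1)%N by lia.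
have /(dvdXn_coef step) /eqP : (n.+1 + m.-1 < n.+1 + m)%N by lia.
rewrite iE coefB coefB coefZ coefXn eqxx mulr1 -addrA -opprD subr_eq0 => /eqP ->.
by rewrite mulrC kE// subrr.
Qed.

Variables (k : nat -> K) (A : R).
Hypothesis A_ge1 : 1 <= A.
Hypothesis rho_le : vabs rho <= A ^+ m.-1.
Hypothesis f_le : forall i, vabs (f i - 'X`_i) <= vabs rho / A ^+ m * A ^+ i.
Hypothesis g_le : forall N, wbound (GRing.exp A) 1 (1 + trunc N g).
Hypothesis d_le : forall N, (m <= N)%N ->
  wbound (GRing.exp A) (vabs rho / A ^+ m.-1) (trunc N g - (r \Po trunc N h)).
Hypothesis k0 : k 0 = 1.
Hypothesis k_rec : forall n, (0 < n)%N ->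
  (n%:R * rho) * k n = - (fibre_defect (n + m) (trunc n k))`_(n + m.-1).

(** The recursion is linear in [k]: each step divides by [n] a combination of
    coefficients whose weights are at most that of index [n - 1]. *)
Lemma fibre_conjugacy_bound n : vabs (k n) <= A ^+ n * invfact K n.
Proof.
have A_gt0 : 0 < A := lt_le_trans ltr01 A_ge1.
elim/ltn_ind: n => -[|n] IH; first by rewrite k0 expr0 mul1r vabs1 invfact0.
set P := trunc n.+1 k; set i := (n.+1 + m.-1)%N; set N := (n.+1 + m)%N.
have W0 : 0 <= invfact K n by exact: invfact_ge0.
pose B := vabs rho * A ^+ n.+1 * invfact K n.
have B0 : 0 <= B by rewrite /B !mulr_ge0 ?vabs_ge0 ?exprn_ge0 ?(ltW A_gt0).
suff : vabs (fibre_defect N P)`_i <= B.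
  rewrite -vabsN -k_rec// !vabsM => H.
  have d0 : 0 < (vabs (n.+1%:R : K) : R) by rewrite vabs_gt0// (pcharf0P _).1.
  rewrite -(ler_pM2l (mulr_gt0 d0 (vabs_gt0 rho_neq0))).
  apply: le_trans H _; rewrite /B -invfactS// le_eqVlt; apply/orP; left.
  by apply/eqP; ring.
have PW : wbound (GRing.exp A) (invfact K n) P.
  move=> j; rewrite coef_trunc; case: ltnP => [jn|_]; last first.
    by rewrite vabs0 mulr_ge0 ?exprn_ge0 ?(ltW A_gt0).
  apply: le_trans (IH j jn) _.
  by rewrite mulrC ler_wpM2r ?exprn_ge0 ?(ltW A_gt0)// invfact_le.
have N2 : (2 <= N)%N by rewrite /N; move: m_ge2; clear; lia.
have -> : fibre_defect N P = ((P \Po trunc N f) - P) * (1 + trunc N g)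
    + P * (trunc N g - (r \Po trunc N h)) by rewrite /fibre_defect; ring.
have C0 : 0 <= vabs rho / A ^+ m.
  by rewrite divr_ge0 ?vabs_ge0 ?exprn_ge0 ?(ltW A_gt0).
have D0 : 0 <= vabs rho / A ^+ m.-1.
  by rewrite divr_ge0 ?vabs_ge0 ?exprn_ge0 ?(ltW A_gt0).
rewrite coefD; apply: vabsD_le; last first.
  apply: le_trans (gboundM A_ge1 W0 D0 PW (d_le _) i) _; first by rewrite /N leq_addl.
  rewrite /B /i exprD le_eqVlt; apply/orP; left; apply/eqP.
  have : A ^+ m.-1 != 0 by rewrite expf_neq0 ?gt_eqF.
  by move: (A ^+ n.+1) (A ^+ m.-1) => a b b0; field.
rewrite -{2}(comp_polyXr P) !comp_polyE -sumrB mulr_suml coef_sum.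
apply: vabs_sum_le => // -[j _] _ /=; rewrite -scalerBr -scalerAl coefZ vabsM.
case: j => [|j]; first by rewrite !expr0 subrr mul0r coef0 vabs0 mulr0.
have qb := gbound_expB_X A_ge1 j.+1 C0
  (gbound_trunc_jet m_ge2 A_ge1 rho_le f_le N2) (gbound_jet A_ge1 f_le N2).
have qC : 0 <= vabs rho / A ^+ m * A^-1 ^+ j.
  by rewrite mulr_ge0// exprn_ge0// invr_ge0 ltW.
have qgb := gboundM A_ge1 qC ler01 qb (g_le N).
apply: le_trans (ler_pM (vabs_ge0 _) (vabs_ge0 _) (PW j.+1) (qgb i)) _.
have -> : i = (n + m)%N by rewrite /i; move: m_ge2; clear; lia.
rewrite /B exprVn exprD 2!exprS le_eqVlt; apply/orP; left; apply/eqP.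
have : A ^+ m != 0 by rewrite expf_neq0 ?gt_eqF.
have : A ^+ j != 0 by rewrite expf_neq0 ?gt_eqF.
by move: (A ^+ j) (A ^+ m) (A ^+ n) => a b c a0 b0; field; rewrite a0.
Qed.

End SecondComponent.

(** * Convergence and sums of power series *)

Section Convergence.
Context {R : realType} {K : completeNonArchFieldType R}.
Implicit Types (u v : nat -> K) (l x y : K) (p : {poly K}).

Lemma vcvg_toP u l : vcvg_to u l <->
  forall e : R, 0 < e -> exists N, forall n, (N <= n)%N -> vabs (u n - l) < e.
Proof.
split=> [/cvgrPdist_lt H e e0|H].
  have [N _ HN] := H e e0; exists N => n Nn; have := HN n Nn.
  by rewrite /= sub0r normrN ger0_norm ?vabs_ge0.
apply/cvgrPdist_lt => e /H[N HN]; exists N => // n /= /HN.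
by rewrite sub0r normrN ger0_norm ?vabs_ge0.
Qed.

Lemma geometric_small (C theta e : R) : 0 <= theta < 1 -> 0 < e ->
  exists N, forall n, (N <= n)%N -> C * theta ^+ n < e.
Proof.
move=> /andP[t0 t1] e0.
have /cvgrPdist_lt/(_ _ e0)[N _ HN] : (fun n => C * theta ^+ n) @ \oo --> (0 : R).
  by apply: cvg_geometric; rewrite ger0_norm.
exists N => n /HN /=; rewrite sub0r normrN; exact/le_lt_trans/ler_norm.
Qed.

Lemma vcvg_small (C theta : R) u l : 0 <= theta < 1 ->
  (forall n, vabs (u n - l) <= C * theta ^+ n) -> vcvg_to u l.
Proof.
move=> th H; apply/vcvg_toP => e /(geometric_small C th)[N HN].
by exists N => n /HN; apply: le_lt_trans (H n).
Qed.

Lemma vcvg_le u l y (c : R) N :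
  vcvg_to u l -> (forall n, (N <= n)%N -> vabs (u n - y) <= c) -> vabs (l - y) <= c.
Proof.
move=> /vcvg_toP ul uc; rewrite leNgt; apply/negP => c_lt.
have l_gt0 : 0 < vabs (l - y) :> R.
  by apply: le_lt_trans c_lt; apply: le_trans (uc N (leqnn N)); apply: vabs_ge0.
have [M HM] := ul _ l_gt0; set n := maxn N M.
have := vabsD_max (u n - y) (- (u n - l)).
have -> : u n - y - (u n - l) = l - y by ring.
rewrite vabsN leNgt gt_max (le_lt_trans (uc n (leq_maxl _ _)) c_lt) HM//.
exact: leq_maxr.
Qed.

Lemma vcvg_unique u l y : vcvg_to u l -> vcvg_to u y -> l = y.
Proof.
move=> ul /vcvg_toP uy; apply/eqP; rewrite -subr_eq0; apply/eqP/(@vabs_eq0 R).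
apply/eqP; rewrite eq_le vabs_ge0 andbT; apply/ler_addgt0Pr => e e0.
rewrite add0r; have [N HN] := uy e e0.
by apply: (vcvg_le (N := N)) ul _ => n /HN/ltW.
Qed.

Lemma vcvg_cst l : vcvg_to (fun=> l) l.
Proof. by apply/vcvg_toP => e e0; exists 0 => n _; rewrite subrr vabs0. Qed.

Lemma vcvgD u v l y : vcvg_to u l -> vcvg_to v y ->
  vcvg_to (fun n => u n + v n) (l + y).
Proof.
move=> /vcvg_toP ul /vcvg_toP vy; apply/vcvg_toP => e e0.
have [[M HM] [N HN]] := (ul e e0, vy e e0).
exists (maxn M N) => n; rewrite geq_max => /andP[/HM uln /HN vyn].
rewrite opprD addrACA; apply: le_lt_trans (vabsD_max _ _) _.
by rewrite gt_max uln vyn.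
Qed.

Lemma vcvgZ c u l : vcvg_to u l -> vcvg_to (fun n => c * u n) (c * l).
Proof.
have [->|c0] := eqVneq c 0.
  move=> _; rewrite mul0r; under [fun n => _]funext do rewrite mul0r.
  exact: vcvg_cst.
have vc0 := vabs_gt0 c0; move=> /vcvg_toP ul; apply/vcvg_toP => e e0.
have [N HN] := ul _ (divr_gt0 e0 vc0); exists N => n /HN.
by rewrite -mulrBr vabsM ltr_pdivlMr// mulrC.
Qed.

Lemma vcvgB u v l y : vcvg_to u l -> vcvg_to v y ->
  vcvg_to (fun n => u n - v n) (l - y).
Proof.
move=> ul /(vcvgZ (-1)); rewrite mulN1r => vy; have := vcvgD ul vy.
by under [fun n => _]funext do rewrite mulN1r.
Qed.

Lemma vcvg0P u l : vcvg_to u l <-> vcvg_to (fun n => u n - l) 0.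
Proof.
by rewrite !vcvg_toP; split=> H e /H[N HN]; exists N => n /HN; rewrite subr0.
Qed.

Lemma vcvgM u v l y : vcvg_to u l -> vcvg_to v y ->
  vcvg_to (fun n => u n * v n) (l * y).
Proof.
move=> ul vy.
have uv0 : vcvg_to (fun n => (u n - l) * (v n - y)) 0.
  move/vcvg_toP: ul => ul; move/vcvg_toP: vy => vy; apply/vcvg_toP => e e0.
  have [[M HM] [N HN]] := (ul 1 ltr01, vy e e0).
  exists (maxn M N) => n; rewrite geq_max => /andP[/HM/ltW uln /HN vyn].
  by rewrite subr0 vabsM; apply: le_lt_trans vyn; rewrite ler_piMl ?vabs_ge0.
apply/vcvg0P; have := vcvgD (vcvgD uv0 (vcvgZ l ((vcvg0P _ _).1 vy)))
  (vcvgZ y ((vcvg0P _ _).1 ul)).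
rewrite !mulr0 !addr0; congr vcvg_to; apply/funext => n; ring.
Qed.

Lemma vcvg_horner p u l : vcvg_to u l -> vcvg_to (fun n => p.[u n]) p.[l].
Proof.
move=> ul; elim/poly_ind: p => [|p c IH].
  by rewrite horner0; under [fun n => _]funext do rewrite horner0; apply: vcvg_cst.
rewrite hornerMXaddC; under [fun n => _]funext do rewrite hornerMXaddC.
by apply: vcvgD (vcvg_cst c); apply: vcvgM.
Qed.

(** In an ultrametric space a sequence is Cauchy as soon as its steps tend
    to 0. *)
Lemma geometric_steps_cvg u (C theta : R) : 0 <= theta < 1 ->
  (forall n, vabs (u n.+1 - u n) <= C * theta ^+ n) -> exists l, vcvg_to u l.
Proof.
move=> th H; have [th0 th1] := andP th; have C0 : 0 <= C.
  by have := le_trans (vabs_ge0 _) (H 0); rewrite expr0 mulr1.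
have tail N k : vabs (u (N + k)%N - u N) <= C * theta ^+ N.
  elim: k => [|k IH]; first by rewrite addn0 subrr vabs0 mulr_ge0 ?exprn_ge0.
  rewrite addnS -(subrK (u (N + k)%N) (u _.+1)) -addrA vabsD_le//.
  apply: le_trans (H _) _; rewrite ler_wpM2l// exprD ler_piMr ?exprn_ge0//.
  by rewrite exprn_ile1// ltW.
apply: vabs_complete => e /(geometric_small C th)[N HN]; exists N => i j Ni Nj.
apply: le_lt_trans (HN N (leqnn N)).
rewrite -(subnKC Ni) -(subnKC Nj) -(subrK (u N) (u (N + (i - N))%N)) -addrA.
by rewrite vabsD_le// -vabsN opprB.
Qed.

(** Banach's fixed point theorem: [id + phi] is onto if [phi] is a
    contraction. *)
Lemma contraction_onto (phi : K -> K) (t theta : R) : 0 <= theta < 1 ->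
  phi 0 = 0 ->
  (forall x y, vabs x <= t -> vabs y <= t ->
     vabs (phi x - phi y) <= theta * vabs (x - y)) ->
  forall w, vabs w <= t -> exists2 x, vabs x <= vabs w :> R & x + phi x = w.
Proof.
move=> th phi0 phiB w wt; have [th0 th1] := andP th.
have phi_le x : vabs x <= vabs w :> R -> vabs (phi x) <= vabs w :> R.
  move=> xw; have := phiB x 0; rewrite vabs0 phi0 !subr0.
  move=> /(_ (le_trans xw wt) (le_trans (vabs_ge0 _) wt)) /le_trans; apply.
  by apply: le_trans xw; rewrite ler_piMl ?vabs_ge0// ltW.
pose s n := iter n (fun x => w - phi x) 0.
have s_le n : vabs (s n) <= vabs w :> R.
  by elim: n => [|n IH]; rewrite /s /= ?vabs0 ?vabs_ge0// vabsB_le// phi_le.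
have sB n : vabs (s n.+1 - s n) <= vabs w * theta ^+ n.
  elim: n => [|n IH]; first by rewrite /s /= phi0 !subr0 expr0 mulr1.
  have -> : s n.+2 - s n.+1 = - (phi (s n.+1) - phi (s n)) by rewrite /s /=; ring.
  rewrite vabsN; apply: le_trans (phiB _ _ _ _) _; rewrite ?(le_trans (s_le _))//.
  by rewrite exprS mulrCA ler_wpM2l.
have [x sx] := geometric_steps_cvg th sB.
have xw : vabs x <= vabs w :> R.
  by rewrite -[x]subr0; apply: (vcvg_le (N := 0)) sx _ => n _; rewrite subr0.
exists x => //.
have s1x : vcvg_to (fun n => s n.+1) (w - phi x).
  move/vcvg_toP: sx => sx; apply/vcvg_toP => e /sx[N HN]; exists N => n /HN.
  apply: le_lt_trans; have -> : s n.+1 - (w - phi x) = - (phi (s n) - phi x).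
    by rewrite /s /=; ring.
  rewrite vabsN; apply: le_trans (phiB _ _ _ _) _; rewrite ?(le_trans _ wt)//.
  by rewrite ler_piMl ?vabs_ge0// ltW.
have s2x : vcvg_to (fun n => s n.+1) x.
  by move/vcvg_toP: sx => sx; apply/vcvg_toP => e /sx[N HN]; exists N => n /leqW/HN.
by rewrite {1}(vcvg_unique s2x s1x) subrK.
Qed.

End Convergence.

Section PowerSeriesSums.
Context {R : realType} {K : completeNonArchFieldType R}.
Implicit Types (a : nat -> K) (x y : K) (p : {poly K}).

Lemma series_trunc a x :
  series (fun n => a n * x ^+ n) = fun N => (trunc N a).[x].
Proof. by apply/funext => N; rewrite /series /= horner_poly big_mkord. Qed.

(** The nontrivial valuation supplies a nonzero point of the disc of
    convergence, at which the terms of the series are bounded. *)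
Lemma ps_analytic_bound a : ps_analytic a ->
  exists D A : R, 1 <= A /\ forall n, vabs (a n) <= D * A ^+ n.
Proof.
move=> [r r0 ra].
have [z [z0 z1]] := @vabs_nontrivial R K.
have [w w0 w1] : exists2 w : K, w != 0 & vabs w < 1 :> R.
  have [lt|gt|eq] := ltgtP (vabs z : R) 1; first by exists z.
    exists z^-1; first by rewrite invr_eq0.
    by rewrite vabsV invf_lt1// (lt_trans ltr01).
  by rewrite eq eqxx in z1.
have wv := vabs_gt0 w0.
have wi : 0 <= (vabs w : R) < 1 by rewrite vabs_ge0.
have [N HN] := geometric_small 1 wi r0.
have wNr : vabs (w ^+ N) < r by have := HN N (leqnn N); rewrite mul1r vabsX.
have [l] := ra _ wNr.
rewrite /ps_sums_to series_trunc => /vcvg_toP/(_ 1 ltr01)[M HM].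
set x := w ^+ N in HM; have xv : 0 < (vabs x : R) by rewrite vabs_gt0// expf_neq0.
have x1 : vabs x <= 1 :> R by rewrite vabsX exprn_ile1// ltW.
have term n : (M <= n)%N -> vabs (a n) * vabs x ^+ n <= 1 :> R.
  move=> Mn; rewrite -vabsX -vabsM.
  have -> : a n * x ^+ n = ((trunc n.+1 a).[x] - l) - ((trunc n a).[x] - l).
    by rewrite truncS !hornerE; ring.
  by apply: vabsB_le; apply/ltW/HM => //; apply: leqW.
exists (1 + \sum_(i < M) vabs (a i)), (vabs x)^-1; split; first by rewrite invf_ge1.
move=> n; rewrite exprVn ler_pdivlMr ?exprn_gt0//.
have S0 : 0 <= \sum_(i < M) vabs (a i) :> R.
  by rewrite sumr_ge0// => i _; apply: vabs_ge0.
have [/term/le_trans|nM] := leqP M n; first by apply; rewrite lerDl.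
apply: (@le_trans _ _ (vabs (a n))).
  by rewrite ler_piMr ?vabs_ge0// exprn_ile1// vabs_ge0.
rewrite (bigD1 (Ordinal nM))//= addrCA lerDl addr_ge0//.
by rewrite sumr_ge0// => i _; apply: vabs_ge0.
Qed.

Section MajorizedSeries.
Variables (a : nat -> K) (D A t : R).
Hypotheses (a_le : forall n, vabs (a n) <= D * A ^+ n) (A_gt0 : 0 < A).
Hypotheses (t_ge0 : 0 <= t) (At_lt1 : A * t < 1).

Let D_ge0 : 0 <= D.
Proof. by have := le_trans (vabs_ge0 _) (a_le 0); rewrite expr0 mulr1. Qed.

Let At : 0 <= A * t < 1.
Proof. by rewrite At_lt1 mulr_ge0 ?(ltW A_gt0). Qed.

Lemma ps_eval_cvg x : vabs x <= t -> vcvg_to (fun N => (trunc N a).[x]) (ps_eval a x).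
Proof.
move=> xt; have [l ul] : exists l, vcvg_to (fun N => (trunc N a).[x]) l.
  apply: (geometric_steps_cvg (C := D) At) => n.
  rewrite truncS !hornerE addrC addrA addNr add0r vabsM vabsX.
  rewrite exprMn mulrA ler_pM ?vabs_ge0 ?exprn_ge0 ?vabs_ge0//.
  by rewrite lerXn2r ?nnegrE ?vabs_ge0.
have := @xgetPex _ 0 (ps_sums_to a x).
rewrite /ps_eval /ps_sums_to series_trunc; apply.
by exists l.
Qed.

Lemma majorized_analytic : 0 < t -> ps_analytic a.
Proof.
move=> t0; exists t => // x /ltW/ps_eval_cvg xa; exists (ps_eval a x).
by rewrite /ps_sums_to series_trunc.
Qed.

Lemma vabs_expB x y n : vabs x <= t -> vabs y <= t ->
  vabs (x ^+ n - y ^+ n) <= vabs (x - y) * t ^+ n.-1.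
Proof.
move=> xt yt; rewrite subrXX vabsM ler_wpM2l ?vabs_ge0//.
apply: vabs_sum_le => [|[i ni] _ /=]; first exact: exprn_ge0.
rewrite vabsM !vabsX; have -> : n.-1 = (n.-1 - i + i)%N by move: ni; clear; lia.
by rewrite addnK exprD ler_pM ?exprn_ge0 ?vabs_ge0// lerXn2r ?nnegrE ?vabs_ge0.
Qed.

(** As [A * t < 1], the Lipschitz constant of the linear term dominates those of
    the terms of higher degree. *)
Lemma horner_trunc_lip N x y : vabs x <= t -> vabs y <= t ->
  vabs ((trunc N a).[x] - (trunc N a).[y]) <= D * A * vabs (x - y).
Proof.
move=> xt yt; rewrite !horner_poly -sumrB.
have B0 : 0 <= D * A * vabs (x - y) by rewrite !mulr_ge0 ?vabs_ge0 ?(ltW A_gt0).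
apply: vabs_sum_le => // -[[|i] _] _ /=; first by rewrite subrr vabs0.
rewrite -mulrBr vabsM.
apply: le_trans (ler_pM (vabs_ge0 _) (vabs_ge0 _) (a_le _) (vabs_expB i.+1 xt yt)) _.
have -> : D * A ^+ i.+1 * (vabs (x - y) * t ^+ i) = D * A * vabs (x - y) * (A * t) ^+ i.
  by rewrite exprS exprMn; ring.
by rewrite ler_piMr// exprn_ile1//; have /andP[? /ltW] := At.
Qed.

Lemma ps_eval_cvg_comp u x : (forall n, vabs (u n) <= t) -> vabs x <= t ->
  vcvg_to u x -> vcvg_to (fun N => (trunc N a).[u N]) (ps_eval a x).
Proof.
move=> ut xt ux.
have d0 : vcvg_to (fun N => (trunc N a).[u N] - (trunc N a).[x]) 0.
  move/vcvg_toP: ux => ux; apply/vcvg_toP => e e0.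
  have C0 : 0 < D * A + 1 by rewrite ltr_wpDl ?mulr_ge0 ?(ltW A_gt0).
  have [N HN] := ux _ (divr_gt0 e0 C0); exists N => n /HN.
  rewrite ltr_pdivlMr// subr0; apply: le_lt_trans.
  apply: le_trans (horner_trunc_lip n (ut n) xt) _.
  by rewrite mulrC ler_wpM2l ?vabs_ge0// lerDl.
have := vcvgD d0 (ps_eval_cvg xt); rewrite add0r.
by under [fun n => _]funext do rewrite subrK.
Qed.

End MajorizedSeries.

(** * Series tangent to the identity *)

Section TangentSeries.
Variables (h : nat -> K) (A t : R).
Hypotheses (h0 : h 0 = 0) (h1 : h 1 = 1).
Hypothesis h_le : forall n, vabs (h n) <= A^-1 * A ^+ n.
Hypotheses (A_gt0 : 0 < A) (t_ge0 : 0 <= t) (At_lt1 : A * t < 1).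

(** The terms of degree at least 2 of [h] form a contraction of a small
    disc. *)
Lemma tangent_contraction x y : vabs x <= t -> vabs y <= t ->
  vabs ((ps_eval h x - x) - (ps_eval h y - y)) <= A * t * vabs (x - y).
Proof.
move=> xt yt.
have hc z (zt : vabs z <= t) :=
  vcvgB (ps_eval_cvg h_le A_gt0 t_ge0 At_lt1 zt) (vcvg_cst z).
have := vcvgB (hc x xt) (hc y yt) => /(vcvg_le (y := 0) (N := 2)); rewrite subr0.
apply=> N N2; rewrite subr0.
have At0 : 0 <= A * t by rewrite mulr_ge0// ltW.
have B0 : 0 <= A * t * vabs (x - y) by rewrite mulr_ge0 ?vabs_ge0.
have XN : (size ('X : {poly K}) <= N)%N by rewrite size_polyX.
have XE (z : K) : z = \sum_(i < N) ('X`_i * z ^+ i).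
  by rewrite -(horner_coef_wide z XN) hornerX.
rewrite {2}[x]XE {2}[y]XE !horner_poly -!sumrB.
apply: vabs_sum_le => // -[[|[|i]] iN] _ /=.
- by rewrite h0 coefX !mul0r !subrr vabs0.
- by rewrite h1 coefX !subrr vabs0.
rewrite coefX !mul0r !subr0 -mulrBr vabsM.
apply: le_trans (ler_pM (vabs_ge0 _) (vabs_ge0 _) (h_le _) _) _.
  exact: (vabs_expB t_ge0 i.+2 xt yt).
rewrite exprS mulKf ?gt_eqF//=.
have -> : A ^+ i.+1 * (vabs (x - y) * t ^+ i.+1) = A * t * vabs (x - y) * (A * t) ^+ i.
  by rewrite !exprS exprMn; ring.
by rewrite ler_piMr// exprn_ile1// ltW.
Qed.

Lemma ps_eval_tangent0 : ps_eval h 0 = 0.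
Proof.
have z0 : vabs (0 : K) <= t by rewrite vabs0.
apply: vcvg_unique (ps_eval_cvg h_le A_gt0 t_ge0 At_lt1 z0) _.
under [fun n => _]funext => N do rewrite horner_coef0 coef_trunc h0 if_same.
exact: vcvg_cst.
Qed.

Lemma ps_eval_isometry x y : vabs x <= t -> vabs y <= t ->
  vabs (ps_eval h x - ps_eval h y) = vabs (x - y) :> R.
Proof.
move=> xt yt; have [->|xy] := eqVneq x y; first by rewrite !subrr.
have -> : ps_eval h x - ps_eval h y =
  (x - y) + ((ps_eval h x - x) - (ps_eval h y - y)) by ring.
apply: vabsD_small; apply: le_lt_trans (tangent_contraction xt yt) _.
by rewrite gtr_pMl// vabs_gt0// subr_eq0.
Qed.

Lemma vabs_ps_eval x : vabs x <= t -> vabs (ps_eval h x) = vabs x :> R.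
Proof.
move=> xt; have z0 : vabs (0 : K) <= t by rewrite vabs0.
by have := ps_eval_isometry xt z0; rewrite ps_eval_tangent0 !subr0.
Qed.

Lemma ps_eval_onto w : vabs w <= t ->
  exists2 x, vabs x <= vabs w :> R & ps_eval h x = w.
Proof.
move=> wt; have At : 0 <= A * t < 1 by rewrite At_lt1 mulr_ge0// ltW.
have phi0 : ps_eval h 0 - 0 = 0 by rewrite ps_eval_tangent0 subr0.
have [x xw xE] := contraction_onto At phi0 tangent_contraction wt.
by exists x => //; rewrite -xE addrC subrK.
Qed.

End TangentSeries.
End PowerSeriesSums.

(** * Choice of the growth rate *)

Section GrowthRate.
Context {R : realType} {K : completeNonArchFieldType R}.
Implicit Types (a : nat -> K) (A B C D : R).

(** Enlarging the ratio of a geometric majorant gains any prescribed constant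
    from the order of vanishing. *)
Lemma geometric_absorb C D (s : nat) (eps : R) : 0 < C -> 0 < eps ->
  exists B1 : R, 1 <= B1 /\ forall B, B1 <= B -> forall c : nat -> R,
    (forall i, c i <= D * C ^+ i) -> (forall i, (i <= s)%N -> c i <= 0) ->
    forall i, c i <= eps / B ^+ s * B ^+ i.
Proof.
move=> C0 e0; pose E := `|D| * C ^+ s.+1 / eps.
have E0 : 0 <= E by rewrite !mulr_ge0 ?invr_ge0 ?exprn_ge0 ?(ltW C0) ?(ltW e0).
exists (1 + C + E); split; first by rewrite -addrA lerDl addr_ge0 ?(ltW C0).
move=> B B1 c cD cs i.
have B_ge1 : 1 <= B by apply: le_trans B1; rewrite -addrA lerDl addr_ge0 ?(ltW C0).
have CB : C <= B by apply: le_trans B1; rewrite addrAC lerDr addr_ge0.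
have EB : E <= B by apply: le_trans B1; rewrite lerDr addr_ge0 ?(ltW C0).
have B0 : 0 < B := lt_le_trans ltr01 B_ge1.
have [/cs ci|si] := leqP i s.
  by apply: le_trans ci _; rewrite !mulr_ge0 ?invr_ge0 ?exprn_ge0 ?(ltW e0) ?(ltW B0).
set j := (i - s.+1)%N.
have -> : B ^+ i = B ^+ s * B * B ^+ j by rewrite -exprSr -exprD subnKC.
have -> : eps / B ^+ s * (B ^+ s * B * B ^+ j) = eps * B * B ^+ j.
  have : B ^+ s != 0 by rewrite expf_neq0 ?gt_eqF.
  by move: (B ^+ s) (B ^+ j) => b b' b0; field.
apply: (@le_trans _ _ (`|D| * C ^+ i)).
  by apply: le_trans (cD i) _; rewrite ler_wpM2r ?ler_norm// exprn_ge0 ?(ltW C0).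
rewrite -(subnKC si) -/j exprD mulrA ler_pM ?mulr_ge0 ?exprn_ge0 ?(ltW C0)//.
  by rewrite [leRHS]mulrC -ler_pdivrMr.
by rewrite lerXn2r ?nnegrE ?(ltW C0) ?(ltW B0).
Qed.

(** The majorant [B^-1 * B ^+ n] takes the value 1 at [n = 1] for all [B], so
    that enlarging [B] does not affect a leading coefficient equal to 1. *)
Lemma tangent_growth a C D : 0 < C -> a 0 = 0 -> a 1 = 1 ->
  (forall n, vabs (a n) <= D * C ^+ n) ->
  exists B1, 1 <= B1 /\ forall B, B1 <= B -> forall n, vabs (a n) <= B^-1 * B ^+ n.
Proof.
move=> C0 a0 a1 aD; have [B1 [B1_ge1 BP]] := geometric_absorb D 1 C0 ltr01.
exists B1; split=> // B B1B n.
have B0 : 0 < B by rewrite (lt_le_trans ltr01)// (le_trans B1_ge1).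
case: n => [|[|n]]; first by rewrite a0 vabs0 mulr_ge0 ?invr_ge0 ?exprn_ge0 ?(ltW B0).
  by rewrite a1 vabs1 expr1 mulVf ?gt_eqF.
have := BP B B1B (fun i => if (i <= 1)%N then 0 else vabs (a i)) _ _ n.+2.
rewrite /= expr1 mul1r; apply=> i; last by move=> ->.
by case: ifP => // _; apply: le_trans (vabs_ge0 (a i)) (aD i).
Qed.

Lemma unit_growth a C D : 0 < C -> vabs (a 0) <= 1 :> R ->
  (forall n, vabs (a n) <= D * C ^+ n) ->
  exists B1, 1 <= B1 /\ forall B, B1 <= B -> forall n, vabs (a n) <= 1 * B ^+ n.
Proof.
move=> C0 a0 aD; have [B1 [B1_ge1 BP]] := geometric_absorb D 0 C0 ltr01.
exists B1; split=> // B B1B [|n]; first by rewrite mul1r expr0.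
have := BP B B1B (fun i => if i is 0 then 0 else vabs (a i)) _ _ n.+1.
rewrite /= expr0 divr1; apply=> -[|i] //; exact: le_trans (vabs_ge0 _) (aD _).
Qed.

Lemma polynomial_bound (p : {poly K}) : exists2 D : R, 0 <= D &
  forall B, 1 <= B -> wbound (GRing.exp B) D p.
Proof.
have S0 (P : pred 'I_(size p)) : 0 <= \sum_(i < size p | P i) vabs p`_i :> R.
  by rewrite sumr_ge0// => i _; apply: vabs_ge0.
exists (\sum_(i < size p) vabs p`_i) => // B B1 i.
have Bi : 1 <= B ^+ i by rewrite exprn_ege1.
have [pi|ip] := leqP (size p) i.
  by rewrite nth_default// vabs0 mulr_ge0// (le_trans ler01).
apply: (@le_trans _ _ (\sum_(i < size p) vabs p`_i)); last by rewrite ler_peMr.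
by rewrite (bigD1 (Ordinal ip))//= lerDl.
Qed.

Lemma wbound_trunc a D B N : 0 <= D -> 1 <= B ->
  (forall n, vabs (a n) <= D * B ^+ n) -> wbound (GRing.exp B) D (trunc N a).
Proof.
move=> D0 B1 aD i; rewrite coef_trunc; case: ifP => // _.
by rewrite vabs0 mulr_ge0// exprn_ge0// (le_trans ler01).
Qed.

(** At [i = m] the second bound is an equality for all [B]. *)
Lemma jet_growth m (rho : K) (f : nat -> K) C D : (2 <= m)%N -> rho != 0 -> 0 < C ->
  ps_eqO m.+1 f ('X + rho *: 'X^m) -> (forall n, vabs (f n) <= D * C ^+ n) ->
  exists B1, 1 <= B1 /\ forall B, B1 <= B ->
    vabs rho <= B ^+ m.-1 /\
    forall i, vabs (f i - 'X`_i) <= vabs rho / B ^+ m * B ^+ i.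
Proof.
move=> m2 rho0 C0 fjet fD; have rv := vabs_gt0 rho0.
have [B1 [B1_ge1 BP]] := geometric_absorb D m C0 rv.
exists (B1 + vabs rho); split; first by rewrite (le_trans B1_ge1)// lerDl vabs_ge0.
move=> B B1B; have rB : vabs rho <= B.
  by apply: le_trans B1B; rewrite lerDr (le_trans ler01).
have {}B1B : B1 <= B by apply: le_trans B1B; rewrite lerDl vabs_ge0.
have B_ge1 : 1 <= B := le_trans B1_ge1 B1B.
have B0 : 0 < B := lt_le_trans ltr01 B_ge1.
split.
  apply: le_trans rB _; have -> : m.-1 = m.-2.+1 by lia.
  by rewrite exprS ler_peMr ?(ltW B0)// exprn_ege1.
move=> i; have [im|mi] := leqP i m; last first.
  have -> : f i - 'X`_i = f i.
    rewrite coefX; have -> : (i == 1)%N = false by move: mi m2; clear; lia.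
    by rewrite subr0.
  have := BP B B1B (fun i => if (i <= m)%N then 0 else vabs (f i)) _ _ i.
  rewrite /= leqNgt mi /=; apply=> j; last by move=> ->.
  by case: ifP => // _; apply: le_trans (vabs_ge0 (f j)) (fD j).
rewrite fjet ?ltnS// coefD addrC addKr coefZ coefXn.
have [->|_] := eqVneq i m; first by rewrite mulr1 divfK// expf_neq0 ?gt_eqF.
by rewrite mulr0 vabs0 !mulr_ge0 ?invr_ge0 ?exprn_ge0 ?vabs_ge0 ?(ltW B0).
Qed.

End GrowthRate.

(** * Convergence of the formal conjugacy *)

Section ConvergentConjugacy.
Context {R : realType} {K : completeNonArchFieldType R}.
Variables (m : nat) (rho : K) (f g : nat -> K).
Hypotheses (charK0 : [pchar K] =i pred0) (m_ge2 : (2 <= m)%N).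
Hypotheses (rho_neq0 : rho != 0) (f_jet : ps_eqO m.+1 f ('X + rho *: 'X^m)).
Hypotheses (f_an : ps_analytic f) (g_an : ps_analytic g) (g0 : g 0 = 0).

Lemma convergent_conjugacy : exists (h : nat -> K) mu,
  [/\ h 0 = 0, h 1 = 1,
      exists C D : R, 0 < C /\ forall n, vabs (h n) <= D * C ^+ n
    & forall N, 'X^N %| conj_defect m rho f mu N (trunc N h)].
Proof.
have [h [mu [h0 h1 h_rec h_sol]]] := formal_conjugacy charK0 m_ge2 rho_neq0 f_jet.
exists h, mu; split => //; last first.
  move=> [|[|N]]; [by rewrite expr0 dvd1p| |].
    apply/dvdXnP => -[|//] _; rewrite -horner_coef0 /conj_defect.
    have -> : trunc 1 h = 0.
      by apply/polyP => -[|i]; rewrite coef_trunc coef0 ?h0.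
    have m0 : (m == 0)%N = false by move: m_ge2; clear; lia.
    have m1 : (2 * m - 1 == 0)%N = false by move: m_ge2; clear; lia.
    by rewrite comp_poly0 !expr0n m0 m1 !scaler0 !addr0 subr0 horner0.
  have := h_sol N.+1 isT; set E := conj_defect _ _ _ _ _ _ => dE.
  rewrite -[conj_defect _ _ _ _ _ _](subrK E) dvdp_add//; last first.
    by apply: dvdXn_le dE; move: m_ge2; clear; lia.
  by apply: conj_defect_trunc => //; move: m_ge2; clear; lia.
have [D [A0 [A0_ge1 fD]]] := ps_analytic_bound f_an.
have [B1 [B1_ge1 B1P]] := jet_growth m_ge2 rho_neq0 (lt_le_trans ltr01 A0_ge1) f_jet fD.
pose low n := if (n <= m)%N then h n else 0.
have [Dl Dl0 lowD] := polynomial_bound (trunc m.+1 h).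
have lowE n : low n = (trunc m.+1 h)`_n by rewrite coef_trunc ltnS.
have [B2 [B2_ge1 B2P]] : exists B2 : R, 1 <= B2 /\
    forall B, B2 <= B -> forall n, vabs (low n) <= B^-1 * B ^+ n.
  apply: (tangent_growth (C := 1) (D := Dl)) => //.
    by rewrite /low (ltnW m_ge2).
  by move=> n; rewrite lowE; apply: lowD.
have rv := vabs_gt0 rho_neq0.
(* [A] also absorbs [mu] and the coefficients of [h] of index at most [m], for
   which no estimate by recursion is at hand *)
pose A := B1 + B2 + vabs mu / vabs rho.
have q0 : 0 <= vabs mu / vabs rho :> R by rewrite divr_ge0 ?vabs_ge0.
have B1_ge0 : 0 <= B1 := le_trans ler01 B1_ge1.
have B2_ge0 : 0 <= B2 := le_trans ler01 B2_ge1.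
have AB1 : B1 <= A by rewrite /A -addrA lerDl addr_ge0.
have AB2 : B2 <= A by rewrite /A addrAC lerDr addr_ge0.
have Aq : vabs mu / vabs rho <= A by rewrite /A lerDr addr_ge0.
have A_ge1 : 1 <= A := le_trans B1_ge1 AB1.
have A_gt0 : 0 < A := lt_le_trans ltr01 A_ge1.
have [rho_le f_le] := B1P A AB1.
have mu_le : vabs mu <= vabs rho * A ^+ m.-1.
  rewrite mulrC -ler_pdivrMr//; apply: le_trans Aq _.
  have -> : m.-1 = m.-2.+1 by move: m_ge2; clear; lia.
  by rewrite exprS ler_peMr ?(ltW A_gt0)// exprn_ege1.
have h_le n : (n <= m)%N -> vabs (h n) <= A^-1 * A ^+ n.
  by move=> nm; have := B2P A AB2 n; rewrite /low nm.
have hW := conjugacy_bound charK0 m_ge2 rho_neq0 A_ge1 rho_le mu_le f_le h_le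
  h0 h1 h_rec.
have [C C1 WC] := invfact_geometric charK0.
exists (A * C), A^-1; split; first by rewrite mulr_gt0// (lt_le_trans ltr01).
move=> n; apply: le_trans (hW n) _; rewrite exprMn mulrA ler_wpM2l//.
  by rewrite mulr_ge0 ?invr_ge0 ?exprn_ge0 ?(ltW A_gt0).
by apply: le_trans (WC _); apply: invfact_le => //; apply: leq_subr.
Qed.

Lemma convergent_fibre_conjugacy (h : nat -> K) (C0 D0 : R) :
  h 0 = 0 -> h 1 = 1 -> 0 < C0 -> (forall n, vabs (h n) <= D0 * C0 ^+ n :> R) ->
  exists (r : {poly K}) (k : nat -> K),
  [/\ r.[0] = 0 /\ (size r <= m)%N, k 0 = 1,
      exists C D : R, 0 < C /\ forall n, vabs (k n) <= D * C ^+ n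
    & forall N, 'X^N %| fibre_defect f g h r N (trunc N k)].
Proof.
move=> h0 h1 C0_gt0 hD.
have [r [r0 rm r_jet]] := polynomial_in_h g0 h0 h1 (ltnW m_ge2).
have [k [k0 k_rec k_sol]] :=
  formal_fibre_conjugacy charK0 m_ge2 rho_neq0 f_jet g0 r_jet.
exists r, k; split => //; last first.
  move=> [|N]; first by rewrite expr0 dvd1p.
  have := k_sol N; set E := fibre_defect _ _ _ _ _ _ => dE.
  rewrite -[fibre_defect _ _ _ _ _ _](subrK E) dvdp_add//; last first.
    by apply: dvdXn_le dE; move: m_ge2; clear; lia.
  by apply: fibre_defect_trunc => //; move: m_ge2; clear; lia.
have [Df [Af [Af_ge1 fD]]] := ps_analytic_bound f_an.
have [B1 [B1_ge1 B1P]] := jet_growth m_ge2 rho_neq0 (lt_le_trans ltr01 Af_ge1) f_jet fD.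
have [Dg [Ag [Ag_ge1 gD]]] := ps_analytic_bound g_an.
have g0_le1 : vabs (g 0) <= 1 :> R by rewrite g0 vabs0.
have [B2 [B2_ge1 B2P]] := unit_growth (lt_le_trans ltr01 Ag_ge1) g0_le1 gD.
have [B3 [B3_ge1 B3P]] := tangent_growth C0_gt0 h0 h1 hD.
have [Dr Dr0 rD] := polynomial_bound r.
have B2_ge0 : 0 <= B2 := le_trans ler01 B2_ge1.
have B3_ge0 : 0 <= B3 := le_trans ler01 B3_ge1.
have rv := vabs_gt0 rho_neq0.
(* one geometric majorant for all the truncations of [g - r o h] *)
pose E := B2 + B3; have E_ge1 : 1 <= E by rewrite (le_trans B2_ge1)// lerDl.
have E_gt0 : 0 < E := lt_le_trans ltr01 E_ge1.
have dE N : wbound (GRing.exp E) (1 + Dr) (trunc N g - (r \Po trunc N h)).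
  have E_ge0 := geom_ge0 E_ge1.
  apply: wboundB.
    apply: (wbound_le E_ge0) (wbound_trunc N ler01 E_ge1 (B2P E _)); rewrite ?lerDl//.
  apply: (wbound_le E_ge0) (gbound_comp E_ge1 Dr0 (rD E E_ge1) _); first by rewrite lerDr.
  apply: wbound_trunc => //; first by rewrite invr_ge0 ltW.
  by apply: B3P; rewrite lerDr.
have [B4 [B4_ge1 B4P]] := geometric_absorb (1 + Dr) m.-1 E_gt0 rv.
pose A := B1 + B2 + B4.
have B1_ge0 : 0 <= B1 := le_trans ler01 B1_ge1.
have B4_ge0 : 0 <= B4 := le_trans ler01 B4_ge1.
have AB1 : B1 <= A by rewrite /A -addrA lerDl addr_ge0.
have AB2 : B2 <= A by rewrite /A addrAC lerDr addr_ge0.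
have AB4 : B4 <= A by rewrite /A lerDr addr_ge0.
have A_ge1 : 1 <= A := le_trans B1_ge1 AB1.
have A_gt0 : 0 < A := lt_le_trans ltr01 A_ge1.
have [rho_le f_le] := B1P A AB1.
have g_le N : wbound (GRing.exp A) 1 (1 + trunc N g).
  have A_ge0 := geom_ge0 A_ge1; apply: wboundD; first exact: wbound1.
  by apply: wbound_trunc => //; apply: B2P.
have d_le N : (m <= N)%N ->
    wbound (GRing.exp A) (vabs rho / A ^+ m.-1) (trunc N g - (r \Po trunc N h)).
  move=> mN; apply: (B4P A AB4) => [i|i im]; first exact: dE.
  by rewrite (dvdXn_coef (r_jet N mN)) ?vabs0//; move: im m_ge2; clear; lia.
have kW := fibre_conjugacy_bound charK0 m_ge2 rho_neq0 A_ge1 rho_le f_le g_le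
  d_le k0 k_rec.
have [C C1 WC] := invfact_geometric charK0.
exists (A * C), 1; split; first by rewrite mulr_gt0// (lt_le_trans ltr01).
move=> n; apply: le_trans (kW n) _; rewrite mul1r exprMn ler_wpM2l//.
by rewrite exprn_ge0 ?(ltW A_gt0).
Qed.

End ConvergentConjugacy.

(** * From formal identities to identities of functions *)

Section FunctionalEquations.
Context {R : realType} {K : completeNonArchFieldType R}.
Variables (f g h k : nat -> K) (r : {poly K}) (B D t : R).
Hypotheses (B_ge1 : 1 <= B) (D_ge0 : 0 <= D) (t_ge0 : 0 <= t) (Bt_lt1 : B * t < 1).
Hypotheses (f0 : f 0 = 0) (f1 : f 1 = 1) (h0 : h 0 = 0) (h1 : h 1 = 1).
Hypothesis f_le : forall n, vabs (f n) <= B^-1 * B ^+ n.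
Hypothesis h_le : forall n, vabs (h n) <= B^-1 * B ^+ n.
Hypothesis g_le : forall n, vabs (g n) <= 1 * B ^+ n.
Hypothesis k_le : forall n, vabs (k n) <= 1 * B ^+ n.
Hypothesis r_le : wbound (GRing.exp B) D r.

Let B_gt0 : 0 < B := lt_le_trans ltr01 B_ge1.
Let B_ge0 := geom_ge0 B_ge1.
Let B'_ge0 : 0 <= B^-1. Proof. by rewrite invr_ge0 ltW. Qed.
Let B'_le1 : B^-1 <= 1. Proof. by rewrite invf_le1. Qed.

(** A bound on the coefficients turns the vanishing of more and more of them
    into convergence to 0. *)
Lemma vanishing_defect (E : nat -> {poly K}) (C : R) x : vabs x <= t -> 0 <= C ->
  (forall N, 'X^N %| E N) -> (forall N, wbound (GRing.exp B) C (E N)) ->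
  vcvg_to (fun N => (E N).[x]) 0.
Proof.
move=> xt C0 E_low E_le; have Bt0 : 0 <= B * t by rewrite mulr_ge0// ltW.
apply: (@vcvg_small _ _ C (B * t)) => [|N]; first by rewrite Bt0.
rewrite subr0 horner_coef; have CN0 : 0 <= C * (B * t) ^+ N.
  by rewrite mulr_ge0// exprn_ge0.
apply: vabs_sum_le => // -[i _] _ /=; have [Ni|iN] := leqP N i; last first.
  by rewrite (dvdXn_coef (E_low N) iN) mul0r vabs0.
rewrite vabsM vabsX; apply: (@le_trans _ _ (C * (B * t) ^+ i)).
  rewrite exprMn mulrA ler_pM ?exprn_ge0 ?vabs_ge0 ?(E_le N i)//.
  by rewrite lerXn2r ?nnegrE ?vabs_ge0.
rewrite ler_wpM2l// -(subnKC Ni) exprD ler_piMr ?exprn_ge0// exprn_ile1//.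
exact: ltW.
Qed.

Lemma wbound_f N : wbound (GRing.exp B) B^-1 (trunc N f).
Proof. exact: wbound_trunc. Qed.

Lemma wbound_h N : wbound (GRing.exp B) B^-1 (trunc N h).
Proof. exact: wbound_trunc. Qed.

Lemma cvg_f x : vabs x <= t -> vcvg_to (fun N => (trunc N f).[x]) (ps_eval f x).
Proof. exact: (ps_eval_cvg f_le B_gt0 t_ge0 Bt_lt1). Qed.

Lemma cvg_comp_f (a : nat -> K) C x : (forall n, vabs (a n) <= C * B ^+ n) ->
  vabs x <= t ->
  vcvg_to (fun N => (trunc N a).[(trunc N f).[x]]) (ps_eval a (ps_eval f x)).
Proof.
move=> a_le xt; apply: (ps_eval_cvg_comp a_le B_gt0 t_ge0 Bt_lt1) (cvg_f xt) => [N|].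
  rewrite horner_poly; apply: vabs_sum_le => // -[[|i] _] _ /=.
    by rewrite f0 mul0r vabs0.
  rewrite vabsM vabsX; apply: (@le_trans _ _ ((B * t) ^+ i * t)).
    rewrite exprMn -mulrA -exprSr.
    apply: ler_pM; rewrite ?vabs_ge0 ?exprn_ge0 ?vabs_ge0//.
      by apply: le_trans (f_le _) _; rewrite exprS mulKf ?gt_eqF.
    by rewrite lerXn2r ?nnegrE ?vabs_ge0.
  by rewrite ler_piMl// exprn_ile1 ?mulr_ge0 ?(ltW B_gt0) ?(ltW Bt_lt1).
by rewrite (vabs_ps_eval f0 f1 f_le B_gt0 t_ge0 Bt_lt1).
Qed.

Lemma conjugacy_equation m (rho mu : K) x : vabs x <= t ->
  (forall N, 'X^N %| conj_defect m rho f mu N (trunc N h)) ->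
  ps_eval h (ps_eval f x) =
  ps_eval h x + rho * ps_eval h x ^+ m + mu * ps_eval h x ^+ (2 * m - 1).
Proof.
move=> xt E_low; pose Q : {poly K} := 'X + rho *: 'X^m + mu *: 'X^(2 * m - 1).
have QE y : y + rho * y ^+ m + mu * y ^+ (2 * m - 1) = Q.[y] by rewrite /Q !hornerE.
have hx := ps_eval_cvg h_le B_gt0 t_ge0 Bt_lt1 xt.
have lim := vcvgB (cvg_comp_f h_le xt) (vcvg_horner Q hx).
rewrite QE; apply/eqP; rewrite -subr_eq0; apply/eqP; apply: (vcvg_unique lim).
have -> : (fun N => (trunc N h).[(trunc N f).[x]] - Q.[(trunc N h).[x]]) =
    fun N => (conj_defect m rho f mu N (trunc N h)).[x].
  by apply/funext => N; rewrite -QE /conj_defect !(hornerE, horner_comp).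
pose C : R := 1 + vabs rho + vabs mu.
have C0 : 0 <= C by rewrite !addr_ge0 ?vabs_ge0.
apply: (vanishing_defect xt C0 E_low) => N; have hN := wbound_h N.
have hX n c : wbound (GRing.exp B) (vabs c) (c *: trunc N h ^+ n).
  apply: (wbound_le B_ge0) (wboundZ c (gboundX B_ge1 n B'_ge0 hN)).
  by rewrite ler_piMr ?vabs_ge0// exprn_ile1.
have h1C : wbound (GRing.exp B) C (trunc N h).
  apply: (wbound_le B_ge0) hN; apply: le_trans B'_le1 _.
  by rewrite /C -addrA lerDl addr_ge0 ?vabs_ge0.
apply: wboundB; first exact: gbound_comp (wbound_f N).
apply: wboundD; first apply: wboundD => //.
  apply: (wbound_le B_ge0) (hX m rho).
  by rewrite /C addrAC lerDr addr_ge0 ?vabs_ge0.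
by apply: (wbound_le B_ge0) (hX _ mu); rewrite /C lerDr addr_ge0 ?vabs_ge0.
Qed.

Lemma fibre_conjugacy_equation x : vabs x <= t ->
  (forall N, 'X^N %| fibre_defect f g h r N (trunc N k)) ->
  ps_eval k (ps_eval f x) * (1 + ps_eval g x) = ps_eval k x * (1 + r.[ps_eval h x]).
Proof.
move=> xt E_low.
have hx := ps_eval_cvg h_le B_gt0 t_ge0 Bt_lt1 xt.
have gx := ps_eval_cvg g_le B_gt0 t_ge0 Bt_lt1 xt.
have kx := ps_eval_cvg k_le B_gt0 t_ge0 Bt_lt1 xt.
have lim := vcvgB (vcvgM (cvg_comp_f k_le xt) (vcvgD (vcvg_cst 1) gx))
  (vcvgM kx (vcvgD (vcvg_cst 1) (vcvg_horner r hx))).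
apply/eqP; rewrite -subr_eq0; apply/eqP; apply: (vcvg_unique lim).
have <- : (fun N => (fibre_defect f g h r N (trunc N k)).[x]) = fun N =>
    (trunc N k).[(trunc N f).[x]] * (1 + (trunc N g).[x])
    - (trunc N k).[x] * (1 + r.[(trunc N h).[x]]).
  by apply/funext => N; rewrite /fibre_defect !(hornerE, horner_comp).
have D1_ge0 : 0 <= 1 + D by rewrite addr_ge0.
apply: (vanishing_defect xt D1_ge0 E_low) => N.
have w1 : wbound (GRing.exp B) 1 (1 : {poly K}) by apply: wbound1.
have wk : wbound (GRing.exp B) 1 (trunc N k) by apply: wbound_trunc.
have le1D : 1 <= 1 + D by rewrite lerDl.
rewrite -[1 + D]mul1r; apply: wboundB; apply: gboundM => //.
- exact: gbound_comp (wbound_f N).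
- apply: wboundD; first exact: (wbound_le B_ge0) w1.
  by apply: (wbound_le B_ge0) (wbound_trunc N _ _ g_le).
- apply: wboundD; first exact: (wbound_le B_ge0) w1.
  by apply: (wbound_le B_ge0) (gbound_comp B_ge1 D_ge0 r_le (wbound_h N)); rewrite lerDr.
Qed.

Lemma ps_eval_unit_neq0 x : k 0 = 1 -> vabs x <= t -> ps_eval k x != 0.
Proof.
move=> k0 xt; have kx := ps_eval_cvg k_le B_gt0 t_ge0 Bt_lt1 xt.
have Bt0 : 0 <= B * t by rewrite mulr_ge0// ltW.
have k1 : vabs (ps_eval k x - 1) <= B * t.
  apply: (vcvg_le (N := 1)) kx _ => -[//|N] _.
  rewrite horner_poly big_ord_recl /= k0 expr0 mulr1 addrC addKr.
  apply: vabs_sum_le => // i _; rewrite vabsM vabsX /bump leq0n add1n.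
  apply: (@le_trans _ _ ((B * t) ^+ i.+1)).
    rewrite exprMn ler_pM ?exprn_ge0 ?vabs_ge0//.
      by apply: le_trans (k_le _) _; rewrite mul1r.
    by rewrite lerXn2r ?nnegrE ?vabs_ge0.
  by rewrite exprS ler_piMr// exprn_ile1// ltW.
apply/eqP => k_eq0; move: k1.
by rewrite k_eq0 sub0r vabsN vabs1 leNgt Bt_lt1.
Qed.

End FunctionalEquations.

Theorem theorem1p2 (R : realType) (K : completeNonArchFieldType R)
    (charK0 : [pchar K] =i pred0)
    (lambda : K) (lambda_neq0 : lambda != 0)
    (m : nat) (m_ge2 : (2 <= m)%N)
    (rho : K) (rho_neq0 : rho != 0)
    (f g : nat -> K) (f_an : ps_analytic f) (g_an : ps_analytic g)
    (f_jet : ps_eqO m.+1 f ('X + rho *: 'X^m))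
    (g0 : g 0%N = 0) :
  exists (r : {poly K}) (h k : nat -> K) (mu : K),
    [/\ r.[0] = 0 /\ (size r <= m)%N,
        ps_analytic h /\ ps_analytic k,
        tangent_to_id h /\ k 0%N = 1
      & exists2 G : K * K -> K * K, inverse_germ (H_map h k) G &
          near_origin (fun p =>
            H_map h k (F0_map lambda f g (G p)) =
            normal_form lambda rho mu m r p)].
Proof.
have f0 := f_coef0 m_ge2 f_jet; have f1 := f_coef1 m_ge2 f_jet.
have [h [mu [h0 h1 [Ch [Dh [Ch0 hD]]] h_low]]] :=
  convergent_conjugacy charK0 m_ge2 rho_neq0 f_jet f_an.
have [r [k [[r0 rm] k0 [Ck [Dk [Ck0 kD]]] k_low]]] :=
  convergent_fibre_conjugacy charK0 m_ge2 rho_neq0 f_jet f_an g_an g0 h0 h1 Ch0 hD.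
have [Df [Cf [Cf1 fD]]] := ps_analytic_bound f_an.
have [Dg [Cg [Cg1 gD]]] := ps_analytic_bound g_an.
have [Bh [Bh1 BhP]] := tangent_growth Ch0 h0 h1 hD.
have [Bf [Bf1 BfP]] := tangent_growth (lt_le_trans ltr01 Cf1) f0 f1 fD.
have g0_le1 : vabs (g 0%N) <= 1 :> R by rewrite g0 vabs0.
have [Bg [Bg1 BgP]] := unit_growth (lt_le_trans ltr01 Cg1) g0_le1 gD.
have k0_le1 : vabs (k 0%N) <= 1 :> R by rewrite k0 vabs1.
have [Bk [Bk1 BkP]] := unit_growth Ck0 k0_le1 kD.
have [D D0 rD] := polynomial_bound r.
pose B := Num.max (Num.max Bh Bf) (Num.max Bg Bk).
have /BhP h_le : Bh <= B by rewrite !le_max lexx.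
have /BfP f_le : Bf <= B by rewrite !le_max lexx orbT.
have /BgP g_le : Bg <= B by rewrite !le_max lexx !orbT.
have /BkP k_le : Bk <= B by rewrite !le_max lexx !orbT.
have B1 : 1 <= B by rewrite !le_max Bh1.
have B0 : 0 < B := lt_le_trans ltr01 B1.
pose t : R := (2 * B)^-1; have t0 : 0 < t by rewrite invr_gt0 mulr_gt0.
have Bt1 : B * t < 1.
  by rewrite /t invfM mulrCA divff ?gt_eqF// mulr1 invf_lt1// ltr1n.
have t_ge0 := ltW t0.
pose hinv w := xget 0 [set x : K | vabs x <= t /\ ps_eval h x = w].
have hinvP w : vabs w <= t -> vabs (hinv w) <= t /\ ps_eval h (hinv w) = w.
  move=> wt; apply: (@xgetPex _ 0 [set x : K | vabs x <= t /\ ps_eval h x = w]).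
  have [x xw xE] := ps_eval_onto h0 h1 h_le B0 t_ge0 Bt1 wt.
  by exists x; split => //; apply: le_trans wt.
have k_neq0 x (xt : vabs x <= t) := ps_eval_unit_neq0 B1 t_ge0 Bt1 k_le k0 xt.
exists r, h, k, mu; split => //.
- by split; apply: (majorized_analytic _ B0 t_ge0 Bt1 t0); [exact: h_le|exact: k_le].
- by split=> // -[|[|]] // _; rewrite coefX ?h0 ?h1.
exists (fun p => (hinv p.1, p.2 / ps_eval k (hinv p.1))).
  split; exists t => // -[x y] /= /ltW xt _; rewrite /H_map /=.
    by have [ut ->] := hinvP x xt; rewrite divfK// k_neq0.
  have hxt : vabs (ps_eval h x) <= t.
    by rewrite (vabs_ps_eval h0 h1 h_le B0 t_ge0 Bt1).
  have [ut uE] := hinvP _ hxt; set u := hinv _ in ut uE *.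
  have -> : u = x.
    apply/eqP; rewrite -subr_eq0; apply/eqP/(@vabs_eq0 R).
    rewrite -(ps_eval_isometry h0 h1 h_le B0 t_ge0 Bt1 ut xt) uE.
    by rewrite subrr vabs0.
  by rewrite mulfK// k_neq0.
exists t => // -[w v] /= /ltW wt _.
have [xt hx] := hinvP w wt; set x := hinv w in xt hx *.
have kx := k_neq0 x xt.
have hf := conjugacy_equation B1 t_ge0 Bt1 f0 f1 f_le h_le xt h_low.
have kf := fibre_conjugacy_equation B1 D0 t_ge0 Bt1 f0 f1 f_le h_le g_le k_le
  (rD B B1) xt k_low.
rewrite /H_map /F0_map /normal_form /= hf hx; congr (_, _).
rewrite -mulrA [(1 + _) * _]mulrC kf hx !mulrA; congr (_ * _).
by rewrite divfK.
Qed.
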